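(* Let $(X,\varphi)$ and $(Y,\psi)$ be Cantor minimal systems, and let $x\in X$ and $y\in Y$. Let $C$ and $B$ be Bratteli–Vershik models for $(X,\varphi,x)$ and $(Y,\psi,y)$, respectively. The following statements are equivalent: (1) there is a factor map $\alpha:(X,\varphi)\to(Y,\psi)$ with $\alpha(x)=y$; (2) there is an ordered premorphism $f$ from $B$ to $C$. More precisely, identifying $(X,\varphi,x)$ with $(X_C,\lambda_C,x_{\max})$ and $(Y,\psi,y)$ with $(X_B,\lambda_B,x_{\max})$ via fixed pointed conjugacies, $[f]\mapsto\mathcal{V}([f])$ is a one-to-one correspondence between the set of equivalence classes $[f]$ of ordered premorphisms $f$ from $B$ to $C$ and the set of factor maps $\alpha$ as in (1).
   Context: A Cantor minimal system $(X,\varphi)$ is a minimal homeomorphism $\varphi$ of a space $X$ homeomorphic to the Cantor set. A factor map $(X,\varphi)\to(Y,\psi)$ is a continuous surjection $\alpha:X\to Y$ with $\alpha\circ\varphi=\psi\circ\alpha$. **Bratteli diagrams.** A Bratteli diagram $(V,E)$ consists of a vertex set $V=V_0\sqcup V_1\sqcup\cdots$ with each $V_n$ finite and non-empty and $V_0$ a singleton, and an edge set $E=E_1\sqcup E_2\sqcup\cdots$ with each $E_n$ finite and non-empty, together with maps $r,s:E\to V$ (range, source) such that $r(E_n)\subseteq V_n$, $s(E_n)\subseteq V_{n-1}$, $s^{-1}\{v\}\neq\varnothing$ for all $v\in V$ and $r^{-1}\{v\}\ne\varnothing$ for all $v\in V\setminus V_0$. An ordered Bratteli diagram $(V,E,\geq)$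 is a Bratteli diagram with a partial order on $E$ such that $e,e'$ are comparable iff $r(e)=r(e')$. It is properly ordered if there is exactly one infinite path $x_{\max}=(e_1,e_2,\ldots)$ ($e_i\in E_i$, $r(e_i)=s(e_{i+1})$) consisting of maximal edges, and exactly one, $x_{\min}$, consisting of minimal edges. For $B$ properly ordered, $X_B$ is the space of infinite paths, with the cylinder sets as a basis of the topology, and the Vershik homeomorphism $\lambda_B$ is given by $\lambda_B(x_{\max})=x_{\min}$ and, for other $x=(e_1,e_2,\ldots)$, with $k$ least such that $e_k$ is not maximal, $f_k$ the successor of $e_k$ in $r^{-1}\{r(e_k)\}$ and $(f_1,\ldots,f_{k-1})$ the path of minimal edges from $V_0$ to $s(f_k)$, by $\lambda_B(x)=(f_1,\ldots,f_k,e_{k+1},\ldots)$. **Bratteli–Vershik models.** A Bratteli–Vershik model for $(X,\varphi,x_0)$ is a properly ordered Bratteli diagram $B$ for which there is a homeomorphism $\theta:X\to X_B$ with $\theta\circ\varphi=\lambda_B\circ\theta$ and $\theta(x_0)=x_{\max}$ (a pointed conjugacy). **Edge sets.** An ordered edge set from a finite set $S$ to a finite set $T$ is a finite set $F$ with maps $s:F\to S$, $r:F\to T$ and a linear order on each $r^{-1}\{w\}$, $w\in T$. If $G$ is an ordered edge set from $T$ to $U$, then $F\circ G=\{(e,g)\in F\times G: r(e)=s(g)\}$, with source $s(e)$, range $r(g)$, and order: for $r(g)=r(g')$, $(e,g)<(e',g')$ iff $g<g'$, or $g=g'$ and $e<e'$. Write $F\cong F'$ if there is a (necessarily unique) bijection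 $F\to F'$ preserving sources, ranges and order. For $k<l$, $E_{k,l}=E_{k+1}\circ\cdots\circ E_l$; $E_{k,k}$ consists of one edge from $v$ to $v$ for each $v\in V_k$. **Ordered premorphisms.** An ordered premorphism $f:B=(V,E,\ge)\to C=(W,S,\ge)$ is a triple $(F,(f_n)_{n\ge0},\geq)$ where $(f_n)$ is an unbounded sequence of integers with $0=f_0\le f_1\le\cdots$, and $F=F_0\sqcup F_1\sqcup\cdots$ where each $F_n$ is a non-empty finite ordered edge set from $V_n$ to $W_{f_n}$ such that every $v\in V_n$ is the source and every $w\in W_{f_n}$ the range of some edge of $F_n$, $F_0$ is a singleton, and $E_{n+1}\circ F_{n+1}\cong F_n\circ S_{f_n,f_{n+1}}$ for all $n\ge0$. Premorphisms $f=(F,(f_n),\ge)$, $g=(G,(g_n),\ge)$ from $B$ to $C$ are equivalent if there are positive integers $n_1<m_1<n_2<m_2<\cdots$ with $f_{n_k}<g_{m_k}<f_{n_{k+1}}$ and, for all $k\ge1$, $E_{n_k,m_k}\circ G_{m_k}\cong F_{n_k}\circ S_{f_{n_k},g_{m_k}}$ and $E_{m_k,n_{k+1}}\circ F_{n_{k+1}}\cong G_{m_k}\circ S_{g_{m_k},f_{n_{k+1}}}$; $[f]$ denotes the class of $f$. **The map $\mathcal{V}([f])$.** For an ordered premorphism $f=(F,(f_n)_{n\ge0},\geq)$ from a properly ordered Bratteli diagram $B=(V,E,\ge)$ to a properly ordered Bratteli diagram $C=(W,S,\ge)$, with $F=F_0\sqcup F_1\sqcup\cdots$ and each $F_n$ an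 ordered edge set from $V_n$ to $W_{f_n}$, $\mathcal{V}([f]):X_C\to X_B$ is the following map (depending only on $[f]$). For $x=(s_1,s_2,\ldots)\in X_C$ and $n\ge1$, let $s_0$ be the unique element of $F_0$ and let $(e_1,\ldots,e_n,d_n)\in E_{0,n}\circ F_n$ be the path corresponding to $(s_0,s_1,\ldots,s_{f_n})\in F_0\circ S_{0,f_n}$ under the unique isomorphism $F_0\circ S_{0,f_n}\cong E_{0,n}\circ F_n$; the edges $e_1,\ldots,e_n$ are consistent as $n$ varies, and $\mathcal{V}([f])(x)=(e_1,e_2,\ldots)$. *)

(* Defs.v *)
From HB Require Import structures.
From mathcomp Require Import all_boot.
From mathcomp Require Import boolp classical_sets functions topology cantor.

Set Implicit Arguments.
Unset Strict Implicit.
Unset Printing Implicit Defensive.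

Local Open Scope classical_set_scope.

(* The linear orders on the fibres of [rng] are packed into one partial order
   on the edges for which two edges are comparable iff they have the same
   range. *)
Record edgeset (S T : finType) := EdgeSet {
  edge :> finType;
  src : edge -> S;
  rng : edge -> T;
  ele : rel edge;
  ele_refl : reflexive ele;
  ele_anti : antisymmetric ele;
  ele_trans : transitive ele;
  ele_comparable : forall e e', ele e e' || ele e' e = (rng e == rng e') }.

Arguments src {S T e} _ : rename.
Arguments rng {S T e} _ : rename.
Arguments ele {S T e} _ _ : rename.

Definition elt {S T} {F : edgeset S T} (e e' : F) := (e != e') && ele e e'.

Definition emaximal {S T} {F : edgeset S T} (e : F) :=
  [forall e', ele e e' ==> (e' == e)].

Definition eminimal {S T} {F : edgeset S T} (e : F) :=
  [forall e', ele e' e ==> (e' == e)].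

(* [f] is the successor of [e] in the fibre of [rng e] *)
Definition esucc {S T} {F : edgeset S T} (e f : F) :=
  elt e f && [forall g, elt e g ==> ele f g].

Section IdEdges.
Variable S : finType.

Let id_comparable (e e' : S) : (e == e') || (e' == e) = (e == e').
Proof. by rewrite eq_sym orbb. Qed.

Let id_anti : antisymmetric (fun e e' : S => e == e').
Proof. by move=> x y /andP[/eqP]. Qed.

Let id_trans : transitive (fun e e' : S => e == e').
Proof. by move=> x y z /eqP-> /eqP->. Qed.

Definition eid : edgeset S S :=
  @EdgeSet S S S id id (fun e e' => e == e') (@eqxx S)
    id_anti id_trans id_comparable.

End IdEdges.

Section CompEdges.
Variables (S T U : finType) (F : edgeset S T) (G : edgeset T U).

Definition comp_edge : finType := {p : F * G | rng p.1 == src p.2}.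

Definition comp_le (p q : comp_edge) :=
  elt (val p).2 (val q).2
  || ((val p).2 == (val q).2) && ele (val p).1 (val q).1.

Let comp_refl : reflexive comp_le.
Proof. by move=> p; rewrite /comp_le eqxx ele_refl orbT. Qed.

Let comp_anti : antisymmetric comp_le.
Proof.
move=> p q; rewrite /comp_le /elt (eq_sym (val q).2).
have [e2|n2] /= := eqVneq (val p).2 (val q).2; last first.
  by rewrite !orbF => /ele_anti e2; rewrite e2 eqxx in n2.
move=> /ele_anti e1; apply: val_inj.
by apply/eqP; rewrite -pair_eqE /= e1 e2 !eqxx.
Qed.

Let comp_trans : transitive comp_le.
Proof.
move=> q p t; rewrite /comp_le /elt.
have [->|npq] /= := eqVneq (val p).2 (val q).2.
  have [_|nqt] /= := eqVneq (val q).2 (val t).2; last by rewrite !orbF.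
  exact: ele_trans.
rewrite orbF; have [<-|nqt] /= := eqVneq (val q).2 (val t).2.
  by rewrite (negPf npq) /= orbF.
rewrite orbF => lpq lqt; rewrite (ele_trans lpq lqt) andbT.
have [ept|//] := eqVneq (val p).2 (val t).2; rewrite -ept in lqt.
have /ele_anti e2 : ele (val p).2 (val q).2 && ele (val q).2 (val p).2.
  by rewrite lpq.
by rewrite e2 eqxx in npq.
Qed.

Let comp_comparable p q :
  comp_le p q || comp_le q p = (rng (val p).2 == rng (val q).2).
Proof.
rewrite /comp_le /elt (eq_sym (val q).2).
have [e2|n2] /= := eqVneq (val p).2 (val q).2; last first.
  by rewrite !orbF ele_comparable.
by rewrite ele_comparable (eqP (valP p)) (eqP (valP q)) e2 !eqxx.
Qed.

Definition ecomp : edgeset S U :=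
  @EdgeSet S U comp_edge (fun p => src (val p).1) (fun p => rng (val p).2)
    comp_le comp_refl comp_anti comp_trans comp_comparable.

End CompEdges.

Definition is_eiso {S T : finType} (F F' : edgeset S T) (h : F -> F') :=
  [/\ bijective h, forall e, src (h e) = src e, forall e, rng (h e) = rng e
    & forall e e', ele (h e) (h e') = ele e e'].

Definition eiso {S T : finType} (F F' : edgeset S T) :=
  exists h : F -> F', is_eiso h.

Section CastEdges.
Variables (S : finType) (V : nat -> finType) (m n : nat) (emn : m = n).
Variable F : edgeset S (V m).

Let cast_comparable (e e' : F) :
  ele e e' || ele e' e = (ecast i (V i) emn (rng e) == ecast i (V i) emn (rng e')).
Proof. by case: n / emn; rewrite /= ele_comparable. Qed.

Definition ecast_rng : edgeset S (V n) :=
  @EdgeSet S (V n) F src (fun e => ecast i (V i) emn (rng e)) ele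
    (@ele_refl _ _ F) (@ele_anti _ _ F) (@ele_trans _ _ F) cast_comparable.

End CastEdges.

(* [bE n] is the set of edges from level [n] to level [n.+1], denoted by
   E_{n+1} on paper. *)
Record obratteli := OBratteli {
  bV : nat -> finType;
  bE : forall n, edgeset (bV n) (bV n.+1);
  bV0 : #|bV 0| = 1;
  bV_neq0 : forall n, 0 < #|bV n|;
  bE_neq0 : forall n, 0 < #|bE n|;
  bsrc_surj : forall n (v : bV n), exists e : bE n, src e = v;
  brng_surj : forall n (v : bV n.+1), exists e : bE n, rng e = v }.

(* [epath B k d] is E_{k,k+d}; the composition is bracketed to the left and
   starts with the identity edges of level [k], so that for [d > 0] it is
   E_{k+1} o ... o E_{k+d} up to canonical isomorphism. The addition [d + k] makes
   [d.+1 + k] and [(d + k).+1] convertible. *)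
Fixpoint epath (B : obratteli) (k d : nat) : edgeset (bV B k) (bV B (d + k)) :=
  match d with
  | 0 => eid (bV B k)
  | d'.+1 => ecomp (epath B k d') (bE B (d' + k))
  end.

Definition Elev (B : obratteli) (k l : nat) (kl : k <= l) :
    edgeset (bV B k) (bV B l) :=
  ecast_rng (subnK kl) (epath B k (l - k)).

(* [x n] is the edge e_{n+1} of the infinite path (e_1, e_2, ...). *)
Record bpath (B : obratteli) := BPath {
  bpath_edge :> forall n, bE B n;
  bpathP : forall n, rng (bpath_edge n) = src (bpath_edge n.+1) }.

Definition cylinder (B : obratteli) (x : bpath B) (n : nat) : set (bpath B) :=
  [set y | forall i, i < n -> y i = x i].

Definition bpath_open (B : obratteli) (A : set (bpath B)) :=
  forall x, A x -> exists n, cylinder x n `<=` A.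

Section PathTopology.
Variable B : obratteli.

HB.instance Definition _ := gen_eqMixin (bpath B).
HB.instance Definition _ := gen_choiceMixin (bpath B).

Let openT : bpath_open [set: bpath B].
Proof. by move=> x _; exists 0. Qed.

Let openI : setI_closed (@bpath_open B).
Proof.
move=> A A' oA oA' x [/oA[n sA] /oA'[m sA']]; exists (maxn n m) => y yx.
split; [apply: sA|apply: sA'] => i im; apply: yx.
  by rewrite leq_max im.
by rewrite leq_max im orbT.
Qed.

Let open_bigU (I : Type) (f : I -> set (bpath B)) :
  (forall i, bpath_open (f i)) -> bpath_open (\bigcup_i f i).
Proof.
by move=> of_ x [i _ /(of_ i)[n sf]]; exists n => y /sf fy; exists i.
Qed.

HB.instance Definition _ :=
  isOpenTopological.Build (bpath B) openT openI open_bigU.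

End PathTopology.

Definition max_path (B : obratteli) (x : bpath B) := forall n, emaximal (x n).

Definition min_path (B : obratteli) (x : bpath B) := forall n, eminimal (x n).

Record pobratteli := POBratteli {
  po_diagram :> obratteli;
  po_max : exists! x : bpath po_diagram, max_path x;
  po_min : exists! x : bpath po_diagram, min_path x }.

Definition xmax (B : pobratteli) : bpath B := sval (cid (po_max B)).

Definition xmin (B : pobratteli) : bpath B := sval (cid (po_min B)).

Section FibreOrder.
Variables (S T : finType) (F : edgeset S T).
Implicit Types (e f g : F) (P : pred F).

Lemma elt_rng e f : elt e f -> rng e = rng f.
Proof. by case/andP=> _ ef; apply/eqP; rewrite -ele_comparable ef. Qed.

Lemma fibre_least (t : T) P e : P e -> (forall f, P f -> rng f = t) ->
  exists2 f, P f & forall g, P g -> ele f g.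
Proof.
move=> Pe Pt.
case: (arg_minnP (fun f => #|[set g : F | ele g f]%SET|) Pe) => f Pf fmin.
exists f => // g Pg.
have := ele_comparable f g; rewrite (Pt _ Pf) (Pt _ Pg) eqxx => /orP[//|gf].
have sub : [set h : F | ele h g]%SET \subset [set h : F | ele h f]%SET.
  by apply/fintype.subsetP => h; rewrite !inE => hg; apply: ele_trans hg gf.
have : f \in [set h : F | ele h g]%SET.
  have /eqP-> : [set h : F | ele h g]%SET == [set h : F | ele h f]%SET.
    by rewrite eqEcard sub /=; exact: (fmin g Pg).
  by rewrite inE ele_refl.
by rewrite inE.
Qed.

Lemma ex_esucc e : ~~ emaximal e -> exists f, esucc e f.
Proof.
case/forallPn => f; rewrite negb_imply => /andP[ef nfe].
have eltf : elt e f by rewrite /elt eq_sym nfe.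
have [g eg gl] := @fibre_least (rng e) (elt e) f eltf (fun g h => esym (elt_rng h)).
by exists g; rewrite /esucc eg; apply/forallP => h; apply/implyP => /gl.
Qed.

Lemma ex_eminimal (t : T) e : rng e = t -> exists2 f : F, rng f = t & eminimal f.
Proof.
move=> et; have [||f /eqP ft fl] := @fibre_least t [pred f | rng f == t] e.
- exact/eqP.
- by move=> f /eqP.
exists f => //; apply/forallP => g; apply/implyP => gf; apply/eqP.
apply: (@ele_anti _ _ F); rewrite gf fl //=.
by have := ele_comparable g f; rewrite gf ft => /esym.
Qed.

End FibreOrder.

Section Vershik.

Lemma min_extend (B : obratteli) k (z : forall n, bE B n) :
  (forall i, k <= i -> rng (z i) = src (z i.+1)) ->
  exists y : bpath B, (forall i, k <= i -> y i = z i)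
                   /\ (forall i, i < k -> eminimal (y i)).
Proof.
elim: k z => [z zP|k IH z zP].
  by exists (BPath (fun i => zP i isT)).
have [e0 e0P] := brng_surj (src (z k.+1)).
have [e eP emin] := ex_eminimal e0P.
have [|y [y1 y2]] := IH (dfwith z e).
  move=> i; rewrite leq_eqVlt => /orP[/eqP <-|ki].
    by rewrite dfwith_in dfwith_out // neq_ltn ltnSn.
  by rewrite !dfwith_out ?zP // neq_ltn ?ki // ltnS ltnW.
exists y; split=> i.
  by move=> ki; rewrite y1 ?(ltnW ki)// dfwith_out // neq_ltn ki.
rewrite ltnS leq_eqVlt => /orP[/eqP ->|/y2//].
by rewrite y1 // dfwith_in.
Qed.

Variable B : pobratteli.
Implicit Types x y : bpath B.

Definition vershik_step (x y : bpath B) (k : nat) :=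
  [/\ forall i, i < k -> emaximal (x i), ~~ emaximal (x k),
      esucc (x k) (y k), forall i, i < k -> eminimal (y i)
    & forall i, k < i -> y i = x i].

Definition vershik_graph (x y : bpath B) :=
  (x = xmax B /\ y = xmin B) \/ exists k, vershik_step x y k.

Lemma max_pathE x : max_path x <-> x = xmax B.
Proof.
have [Hm Hu] := svalP (cid (po_max B)).
by split=> [/Hu|->]; [move=> <-|].
Qed.

Lemma ex_vershik x : exists y, vershik_graph x y.
Proof.
have [/max_pathE->|nmax] := pselect (max_path x).
  by exists (xmin B); left.
have exk : exists k, ~~ emaximal (x k).
  apply: contrapT => nk; apply: nmax => n; apply: contrapT => /negP xn.
  by apply: nk; exists n.
have [k nk kmin] := ex_minnP exk.
have [f xf] := ex_esucc nk.
have [|y [y1 y2]] := @min_extend B k (dfwith x f).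
  move=> i; rewrite leq_eqVlt => /orP[/eqP <-|ki].
    rewrite dfwith_in dfwith_out ?neq_ltn ?ltnSn //.
    by rewrite -bpathP; apply/esym/elt_rng; case/andP: xf.
  by rewrite !dfwith_out ?bpathP // neq_ltn ?ki // ltnS ltnW.
exists y; right; exists k; split=> //.
- by move=> i ik; apply: contraTT ik => /kmin; rewrite -leqNgt.
- by rewrite y1 // dfwith_in.
- by move=> i ki; rewrite y1 ?(ltnW ki)// dfwith_out // neq_ltn ki.
Qed.

Definition vershik x : bpath B := sval (cid (ex_vershik x)).

Lemma vershikP x : vershik_graph x (vershik x).
Proof. exact: svalP (cid (ex_vershik x)). Qed.

End Vershik.

(* [f_0 = 0] is an equation, so [F_0] has range in [bV C (pm_lev 0)]. *)
Record premorphism (B C : obratteli) := Premorphism {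
  pm_lev : nat -> nat;
  pm_edge : forall n, edgeset (bV B n) (bV C (pm_lev n));
  pm_lev0 : pm_lev 0 = 0;
  pm_mono : forall n, pm_lev n <= pm_lev n.+1;
  pm_unbounded : forall N, exists n, N < pm_lev n;
  pm_neq0 : forall n, 0 < #|pm_edge n|;
  pm_src : forall n (v : bV B n), exists e : pm_edge n, src e = v;
  pm_rng : forall n (w : bV C (pm_lev n)), exists e : pm_edge n, rng e = w;
  pm_edge0 : #|pm_edge 0| = 1;
  pm_comm : forall n, eiso (ecomp (bE B n) (pm_edge n.+1))
                           (ecomp (pm_edge n) (Elev C (pm_mono n))) }.

Arguments pm_lev {B C} _ _.
Arguments pm_edge {B C} _ _.

(* [n k] and [m k] stand for n_{k+1} and m_{k+1}. *)
Definition pm_equiv (B C : obratteli) (f g : premorphism B C) :=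
  exists (n m : nat -> nat)
    (nm : forall k, n k < m k) (mn : forall k, m k < n k.+1)
    (fg : forall k, pm_lev f (n k) < pm_lev g (m k))
    (gf : forall k, pm_lev g (m k) < pm_lev f (n k.+1)),
  [/\ 0 < n 0,
      forall k, eiso (ecomp (Elev B (ltnW (nm k))) (pm_edge g (m k)))
                     (ecomp (pm_edge f (n k)) (Elev C (ltnW (fg k))))
    & forall k, eiso (ecomp (Elev B (ltnW (mn k))) (pm_edge f (n k.+1)))
                     (ecomp (pm_edge g (m k)) (Elev C (ltnW (gf k))))].

(* The type of equivalence classes. [set (premorphism B C)] would be a universe inconsistency, hence the
   arrow into [Prop]. *)
Record pm_quot (B C : obratteli) := PmQuot {
  pm_mem :> premorphism B C -> Prop;
  pm_memP : exists f, pm_mem = pm_equiv f }.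

Definition pm_class (B C : obratteli) (f : premorphism B C) : pm_quot B C :=
  PmQuot (ex_intro _ f erefl).

Section Segments.
Variables (B : obratteli) (x : bpath B) (k : nat).

Let seg_snoc d (p : {p : epath B k d | rng p == src (x (d + k))}) :
  rng (x (d + k)) == src (x (d.+1 + k)).
Proof. by rewrite (bpathP x). Qed.

Fixpoint segs d : {p : epath B k d | rng p == src (x (d + k))} :=
  match d with
  | 0 => exist _ (src (x k) : epath B k 0) (eqxx _)
  | d'.+1 =>
      let p := segs d' in
      exist _ (exist _ (val p, x (d' + k)) (valP p) : epath B k d'.+1)
        (seg_snoc p)
  end.

End Segments.

(* The finite path formed by the edges of [x] between the levels [k] and
   [l]. *)
Definition seg (B : obratteli) (x : bpath B) (k l : nat) (kl : k <= l) :
  Elev B kl := val (segs x k (l - k)).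

Lemma pm_lev_mono (B C : obratteli) (f : premorphism B C) n :
  pm_lev f 0 <= pm_lev f n.
Proof. by rewrite pm_lev0. Qed.

Definition Vmap_graph (B C : obratteli) (f : premorphism B C)
    (x : bpath C) (y : bpath B) :=
  forall n, 0 < n ->
  exists (h : ecomp (pm_edge f 0) (Elev C (pm_lev_mono f n)) ->
              ecomp (Elev B (leq0n n)) (pm_edge f n))
         (p : ecomp (pm_edge f 0) (Elev C (pm_lev_mono f n))),
  [/\ is_eiso h, (val p).2 = seg x (pm_lev_mono f n)
    & (val (h p)).1 = seg y (leq0n n)].

Lemma eiso_id (S T : finType) (F : edgeset S T) : is_eiso (@id F).
Proof. by split=> //; exists id. Qed.

Lemma eiso_comp (S T : finType) (F F' F'' : edgeset S T) (h : F -> F') (h' : F' -> F'') :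
  is_eiso h -> is_eiso h' -> is_eiso (h' \o h).
Proof.
move=> [bh hs hr hl] [bh' hs' hr' hl']; split; first exact: bij_comp.
- by move=> e; rewrite /= hs' hs.
- by move=> e; rewrite /= hr' hr.
- by move=> e e'; rewrite /= hl' hl.
Qed.

Lemma eiso_inv (S T : finType) (F F' : edgeset S T) (h : F -> F') : is_eiso h ->
  exists h' : F' -> F, [/\ is_eiso h', cancel h h' & cancel h' h].
Proof.
move=> [[h' hK h'K] hs hr hl]; exists h'; split=> //; split; first by exists h.
- by move=> e; rewrite -[in RHS](h'K e) hs.
- by move=> e; rewrite -[in RHS](h'K e) hr.
- by move=> e e'; rewrite -[in RHS](h'K e) -[in RHS](h'K e') hl.
Qed.

Lemma eiso_ecomp (S T U : finType) (F F' : edgeset S T) (G G' : edgeset T U)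
    (h : F -> F') (k : G -> G') : is_eiso h -> is_eiso k ->
  exists t : ecomp F G -> ecomp F' G', is_eiso t /\
    forall p, val (t p) = (h (val p).1, k (val p).2).
Proof.
move=> ih ik; have [h' [ih' hK h'K]] := eiso_inv ih.
have [k' [ik' kK k'K]] := eiso_inv ik.
case: ih => _ hs hr hl; case: ik => bk ks kr kl.
case: ih' => _ _ hr' _; case: ik' => _ ks' _ _.
have tP (p : ecomp F G) : rng (h (val p).1) == src (k (val p).2).
  by rewrite hr ks; exact: valP p.
have tP' (p : ecomp F' G') : rng (h' (val p).1) == src (k' (val p).2).
  by rewrite hr' ks'; exact: valP p.
pose t (p : ecomp F G) : ecomp F' G' := exist _ (h (val p).1, k (val p).2) (tP p).
pose t' (p : ecomp F' G') : ecomp F G := exist _ (h' (val p).1, k' (val p).2) (tP' p).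
exists t; split=> //; split.
- exists t' => p; apply: val_inj; rewrite /= ?hK ?kK ?h'K ?k'K; exact/esym/surjective_pairing.
- by move=> e; rewrite /= hs.
- by move=> e; rewrite /= kr.
- move=> e e'; rewrite /= /comp_le /elt /= kl hl; congr (_ && _ || _ && _).
    by rewrite (bij_eq bk).
  by rewrite (bij_eq bk).
Qed.

Lemma eiso_assoc (S T U W : finType) (F : edgeset S T) (G : edgeset T U) (H : edgeset U W) :
  exists t : ecomp F (ecomp G H) -> ecomp (ecomp F G) H, is_eiso t /\
    forall p, [/\ (val (val (t p)).1).1 = (val p).1,
                  (val (val (t p)).1).2 = (val (val p).2).1
                & (val (t p)).2 = (val (val p).2).2].
Proof.
have P1 (p : ecomp F (ecomp G H)) : rng (val p).1 == src (val (val p).2).1.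
  exact: valP p.
have P2 (p : ecomp F (ecomp G H)) :
    rng (val (exist _ ((val p).1, (val (val p).2).1) (P1 p) : ecomp F G)).2
      == src (val (val p).2).2.
  exact: valP (val p).2.
have Q1 (p : ecomp (ecomp F G) H) : rng (val (val p).1).2 == src (val p).2.
  exact: valP p.
have Q2 (p : ecomp (ecomp F G) H) : rng (val (val p).1).1 ==
    src (val (exist _ ((val (val p).1).2, (val p).2) (Q1 p) : ecomp G H)).1.
  exact: valP (val p).1.
exists (fun p => exist _ (exist _ ((val p).1, (val (val p).2).1) (P1 p) : ecomp F G, (val (val p).2).2) (P2 p)).
split=> //; split=> //.
- exists (fun p => exist _ ((val (val p).1).1, exist _ ((val (val p).1).2, (val p).2) (Q1 p) : ecomp G H) (Q2 p)).
    move=> [[f [[g h] gh]] fgh] /=; apply: val_inj; congr (_, _).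
    exact: val_inj.
  move=> [[[[f g] fg] h] fgh] /=; apply: val_inj; congr (_, _).
  exact: val_inj.
- move=> [[f [[g h] gh]] fgh] [[f' [[g' h'] gh']] fgh'].
  rewrite /= /comp_le /= /elt /= /comp_le /elt /= -!val_eqE /= -!pair_eqE /=.
  case: (eqVneq h h') => [->|n] /=; last by rewrite andbF /= !orbF.
  case: (eqVneq g g') => [->|n'] /=; first by [].
  by rewrite !orbF.
Qed.

Lemma eiso_unitr (S T : finType) (F : edgeset S T) :
  exists t : ecomp F (eid T) -> F, is_eiso t /\ forall p, t p = (val p).1.
Proof.
exists (fun p => (val p).1); split=> //; split=> //.
- exists (fun e => exist _ (e, rng e) (eqxx _) : ecomp F (eid T)) => //.
  by move=> [[e v] /= ev]; apply: val_inj; rewrite /= (eqP ev).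
- by move=> [[e v] /= ev]; rewrite (eqP ev).
- move=> [[e v] /= ev] [[e' v'] /= ev']; rewrite /comp_le /elt /=.
  rewrite andNb /= -(eqP ev) -(eqP ev').
  have [//|] := eqVneq (rng e) (rng e').
  by rewrite -ele_comparable => /norP[/negPf ->].
Qed.

Lemma eiso_unitl (S T : finType) (F : edgeset S T) :
  exists t : F -> ecomp (eid S) F, is_eiso t /\
    forall e, val (t e) = (src e, e).
Proof.
exists (fun e => exist _ (src e, e) (eqxx _) : ecomp (eid S) F).
split=> //; split=> //.
- exists (fun p => (val p).2) => //.
  by move=> [[v e] /= ev]; apply: val_inj; rewrite /= (eqP ev).
- move=> e e'; rewrite /= /comp_le /elt /=.
  by have [->|] := eqVneq e e'; rewrite /= ?eqxx ?ele_refl ?orbF.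
Qed.

Section Levels.
Variable B : obratteli.

Lemma rng_segs (x : bpath B) k d m (e : d + k = m) :
  rng (val (segs x k d) : ecast_rng e (epath B k d)) = src (x m).
Proof. by case: m / e; exact/eqP/(valP (segs x k d)). Qed.

Lemma src_segs (x : bpath B) k d : src (val (segs x k d)) = src (x k).
Proof. by elim: d. Qed.

Lemma eiso_cast_id k d (e : d + k = k) :
  exists t : ecast_rng e (epath B k d) -> eid (bV B k), is_eiso t /\
    forall x : bpath B, t (val (segs x k d)) = src (x k).
Proof.
have d0 : d = 0 by apply/eqP; rewrite -(eqn_add2r k) e.
subst d; rewrite (eq_irrelevance e erefl); exists id; split=> //.
by split=> //; exists id.
Qed.

Lemma eiso_cast_snoc k d d' m (e : d + k = m) (e' : d' + k = m.+1) :
  exists t : ecomp (ecast_rng e (epath B k d)) (bE B m) ->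
             ecast_rng e' (epath B k d'), is_eiso t /\
    forall (x : bpath B)
        (p : ecomp (ecast_rng e (epath B k d)) (bE B m)),
      val p = (val (segs x k d) : ecast_rng e (epath B k d), x m) ->
      t p = val (segs x k d').
Proof.
have dd : d' = d.+1 by apply/eqP; rewrite -(eqn_add2r k) e' addSn e.
subst d' m; rewrite (eq_irrelevance e' erefl).
exists id; split; first by split=> //; exists id.
by move=> x p px; apply: val_inj.
Qed.

Lemma eiso_cast_cat k l m d1 d2 d
    (e1 : d1 + k = l) (e2 : d2 + l = m) (e : d + k = m) :
  exists t : ecomp (ecast_rng e1 (epath B k d1)) (ecast_rng e2 (epath B l d2)) ->
             ecast_rng e (epath B k d), is_eiso t /\
    forall (x : bpath B)
        (p : ecomp (ecast_rng e1 (epath B k d1)) (ecast_rng e2 (epath B l d2))),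
      val p = (val (segs x k d1) : ecast_rng e1 _,
               val (segs x l d2) : ecast_rng e2 _) ->
      t p = val (segs x k d).
Proof.
elim: d2 m d e2 e => [|d2 IH] m d e2 e.
  have lm : l = m := e2; case: m / lm in e2 e *; have dd : d = d1.
    by apply/eqP; rewrite -(eqn_add2r k) e1 e.
  subst d; rewrite (eq_irrelevance e e1).
  have [u [iu uE]] := eiso_cast_id e2.
  have [t [it tE]] := eiso_ecomp (eiso_id (ecast_rng e1 (epath B k d1))) iu.
  have [s [is_ sE]] := eiso_unitr (ecast_rng e1 (epath B k d1)).
  exists (s \o t); split; first exact: eiso_comp.
  by move=> x p px; rewrite /= sE tE px.
have e2' : d2 + l = m.-1 by rewrite -e2.
have mE : m = m.-1.+1 by rewrite -e2.
move: (m.-1) e2' mE => m' e2' mE.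
move: e2 e; rewrite {}mE {m} => e2 e.
have [d' dE] : exists d', d = d'.+1.
  case: d e => [|d'] e; last by exists d'.
  have : k < m'.+1.
    by rewrite ltnS -e2' -e1; apply: leq_trans (leq_addl d1 k) (leq_addl d2 _).
  by rewrite -e add0n ltnn.
subst d; have e' : d' + k = m' by apply: succn_inj; rewrite -addSn.
have [t [it tE]] := IH m' d' e2' e'.
have [v [iv vE]] := eiso_cast_snoc e2' e2.
have [w [iw wE _]] := eiso_inv iv.
have [a [ia aE]] := eiso_ecomp (eiso_id (ecast_rng e1 (epath B k d1))) iw.
have [b [ib bE_]] := eiso_assoc (ecast_rng e1 (epath B k d1)) (ecast_rng e2' (epath B l d2)) (bE B m').
have [c [ic cE]] := eiso_ecomp it (eiso_id (bE B m')).
have [z [iz zE]] := eiso_cast_snoc e' e.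
exists (z \o (c \o (b \o a))); split.
  by do 3![apply: eiso_comp => //].
move=> x p px; rewrite /=; apply: zE; rewrite cE.
have [b1 b2 b3] := bE_ (a p).
have snocP : rng (val (segs x l d2) : ecast_rng e2' (epath B l d2)) == src (x m').
  by rewrite rng_segs.
have vp := vE x (exist _ (val (segs x l d2) : ecast_rng e2' _, x m') snocP) erefl.
have wp : w (val (segs x l d2.+1)) = exist _ (val (segs x l d2) : ecast_rng e2' _, x m') snocP.
  by rewrite -vp wE.
have a2 : (val (a p)).2 = exist _ (val (segs x l d2) : ecast_rng e2' _, x m') snocP.
  by rewrite aE px /= -wp.
congr (_, _); last by rewrite /= b3 a2.
apply: tE; rewrite [LHS]surjective_pairing b1 b2 a2 aE px.
by [].
Qed.

End Levels.

Section VmapExists.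
Variables (B C : obratteli) (f : premorphism B C).

Let lhs n := ecomp (pm_edge f 0) (Elev C (pm_lev_mono f n)).
Let rhs n := ecomp (Elev B (leq0n n)) (pm_edge f n).

Let snoc n := cid (eiso_cast_snoc B (subnK (leq0n n)) (subnK (leq0n n.+1))).

Let iso0 : exists h : lhs 0 -> rhs 0, is_eiso h.
Proof.
have [u [iu _]] := eiso_cast_id C (subnK (pm_lev_mono f 0)).
have [a [ia _]] := eiso_ecomp (eiso_id (pm_edge f 0)) iu.
have [b [ib _]] := eiso_unitr (pm_edge f 0).
have [c [ic _]] := eiso_unitl (pm_edge f 0).
have [v [iv _]] := eiso_cast_id B (subnK (leq0n 0)).
have [w [iw _ _]] := eiso_inv iv.
have [d [id_ _]] := eiso_ecomp iw (eiso_id (pm_edge f 0)).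
by exists (d \o (c \o (b \o a))); do 3![apply: eiso_comp => //].
Qed.

Let iso_step n (h : lhs n -> rhs n) : is_eiso h ->
  exists h' : lhs n.+1 -> rhs n.+1, is_eiso h' /\
    forall (x : bpath C) (p : lhs n) (p' : lhs n.+1),
      (val p).1 = (val p').1 ->
      (val p).2 = seg x (pm_lev_mono f n) ->
      (val p').2 = seg x (pm_lev_mono f n.+1) ->
      exists q, (val q).1 = (val (h p)).1 /\ (val (h' p')).1 = sval (snoc n) q.
Proof.
move=> ih.
have [c [ic cE]] := eiso_cast_cat C (subnK (pm_lev_mono f n))
  (subnK (pm_mono f n)) (subnK (pm_lev_mono f n.+1)).
have [d [id_ cd _]] := eiso_inv ic.
have [a1 [ia1 a1E]] := eiso_ecomp (eiso_id (pm_edge f 0)) id_.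
have [a2 [ia2 a2E]] := eiso_assoc (pm_edge f 0) (Elev C (pm_lev_mono f n))
  (Elev C (pm_mono f n)).
have [a3 [ia3 a3E]] := eiso_ecomp ih (eiso_id (Elev C (pm_mono f n))).
have [a4' [ia4' a4'E]] := eiso_assoc (Elev B (leq0n n)) (pm_edge f n)
  (Elev C (pm_mono f n)).
have [a4 [ia4 _ a4K]] := eiso_inv ia4'.
have [g ig] := pm_comm f n; have [g' [ig' _ _]] := eiso_inv ig.
have [a5 [ia5 a5E]] := eiso_ecomp (eiso_id (Elev B (leq0n n))) ig'.
have [a6 [ia6 a6E]] := eiso_assoc (Elev B (leq0n n)) (bE B n) (pm_edge f n.+1).
have [isn _] := svalP (snoc n).
have [a7 [ia7 a7E]] := eiso_ecomp isn (eiso_id (pm_edge f n.+1)).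
exists (a7 \o (a6 \o (a5 \o (a4 \o (a3 \o (a2 \o a1)))))).
split; first by do 6![apply: eiso_comp => //].
move=> x p p' pp px px'; rewrite /= a7E /=.
set r := a3 _; exists (val (a6 (a5 (a4 r)))).1; split=> //.
have [-> _ _] := a6E (a5 (a4 r)); rewrite a5E /=.
have [<- _ _] := a4'E (a4 r); rewrite a4K /r a3E /=.
congr (val (h _)).1; apply: val_inj; have [e1 e2 _] := a2E (a1 p').
rewrite [LHS]surjective_pairing e1 e2 [RHS]surjective_pairing pp px a1E /=.
congr (_, _).
have catP : rng (seg x (pm_lev_mono f n)) == src (seg x (pm_mono f n)).
  by rewrite [X in X == _]rng_segs [X in _ == X]src_segs.
pose q : ecomp (Elev C (pm_lev_mono f n)) (Elev C (pm_mono f n)) :=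
  exist _ (seg x (pm_lev_mono f n), seg x (pm_mono f n)) catP.
by rewrite px' -[seg x _](cE x q erefl) cd.
Qed.

Lemma ex_Vmap (x : bpath C) : exists y, Vmap_graph f x y.
Proof.
pose H n := {h : lhs n -> rhs n | is_eiso h}.
pose step n (h : H n) : H n.+1 :=
  let r := cid (iso_step (svalP h)) in exist _ (sval r) (proj1 (svalP r)).
pose fix h n : H n := if n is n'.+1 then step n' (h n') else cid iso0.
have [s0 _] : exists s0 : pm_edge f 0, true.
  by have /card_gt0P[s0 _] := pm_neq0 f 0; exists s0.
have pP n : rng s0 == src (seg x (pm_lev_mono f n)).
  rewrite [X in _ == X]src_segs; apply/eqP.
  have /card_le1_eqP H1 : #|bV C (pm_lev f 0)| <= 1 by rewrite pm_lev0 bV0.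
  exact: H1.
pose p n : lhs n := exist _ (s0, seg x (pm_lev_mono f n)) (pP n).
have hS n : exists q, (val q).1 = (val (sval (h n) (p n))).1 /\
    (val (sval (h n.+1) (p n.+1))).1 = sval (snoc n) q.
  exact: (proj2 (svalP (cid (iso_step (svalP (h n))))) x (p n) (p n.+1)).
pose q n := sval (cid (hS n)).
have q1 n : (val (q n)).1 = (val (sval (h n) (p n))).1.
  by have [] := svalP (cid (hS n)).
have q2 n : (val (sval (h n.+1) (p n.+1))).1 = sval (snoc n) (q n).
  by have [] := svalP (cid (hS n)).
have yP n : rng (val (q n)).2 = src (val (q n.+1)).2.
  rewrite -(eqP (valP (q n.+1))) q1 q2.
  by have [[_ _ -> _] _] := svalP (snoc n).
pose y := BPath yP; exists y => n _.
have yE m : (val (sval (h m) (p m))).1 = seg y (leq0n m).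
  elim: m => [|m IH].
    have /card_le1_eqP H1 : #|bV B 0| <= 1 by rewrite bV0.
    exact: H1.
  rewrite q2; have [_ snocE] := svalP (snoc m); apply: (snocE y).
  by rewrite [LHS]surjective_pairing q1 IH.
by exists (sval (h n)), (p n); split=> //; exact: svalP (h n).
Qed.

End VmapExists.

Definition Vmap (B C : obratteli) (f : premorphism B C) (x : bpath C) :
    bpath B :=
  sval (cid (ex_Vmap f x)).

Lemma VmapP (B C : obratteli) (f : premorphism B C) (x : bpath C) :
  Vmap_graph f x (Vmap f x).
Proof. exact: svalP (cid (ex_Vmap f x)). Qed.

Definition homeomorphism (X Y : topologicalType) (h : X -> Y) :=
  continuous h /\
  exists g : Y -> X, [/\ continuous g, cancel h g & cancel g h].

Definition minimal (X : topologicalType) (phi : X -> X) :=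
  forall A : set X, closed A -> phi @` A = A -> A = set0 \/ A = setT.

Definition cantor_minimal (X : topologicalType) (phi : X -> X) :=
  [/\ exists h : X -> cantor_space, homeomorphism h,
      homeomorphism phi & minimal phi].

Definition factor_map (X Y : topologicalType) (phi : X -> X) (psi : Y -> Y)
    (alpha : X -> Y) :=
  [/\ continuous alpha, forall y, exists x, alpha x = y
    & alpha \o phi =1 psi \o alpha].

Definition pointed_conjugacy (X : topologicalType) (phi : X -> X) (x0 : X)
    (B : pobratteli) (theta : X -> bpath B) :=
  [/\ homeomorphism theta, theta \o phi =1 @vershik B \o theta
    & theta x0 = xmax B].

Definition bv_model (X : topologicalType) (phi : X -> X) (x0 : X)
    (B : pobratteli) :=
  exists theta : X -> bpath B, pointed_conjugacy phi x0 theta.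

Record pointed_factor (X Y : topologicalType) (phi : X -> X) (psi : Y -> Y)
    (x : X) (y : Y) := PointedFactor {
  pf_map :> X -> Y;
  pf_factor : factor_map phi psi pf_map;
  pf_point : pf_map x = y }.

(* Main.v *)
Require Import Defs.
From mathcomp Require Import all_boot.
From mathcomp Require Import boolp classical_sets functions topology cantor.

Set Implicit Arguments.
Unset Strict Implicit.
Unset Printing Implicit Defensive.

(** An ordered edge set [F] from [S] to [T] is determined up to isomorphism by
    its words: to [t : T] it attaches the list of the sources of the edges with
    range [t], read in increasing order ([eiso_word], [word_eiso]), and every
    family of words comes from an edge set ([wedgeset]). Composition of edge
    sets is composition of the substitutions so obtained ([word_ecomp]).

    For a map [alpha] between path spaces, an edge set [F] from level [n] of
    [B] to level [l] of [C] codes [alpha] ([codes]) when the prefix of length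
    [n] of [alpha x] is a function [P] of the prefix of length [l] of [x], and
    when, for each vertex [w] of level [l], the map [P] sends the ordered list
    of the paths to [w] (the tower of [w]) to the concatenation of the towers
    of the letters of the word of [F] at [w]. Three facts carry the proof.

    - Codes compose ([codes_comp]), the edges between two levels code the
      identity ([codes_bE], [codes_Elev]), and the edge sets of a premorphism
      [f] code [Vmap f] ([codes_Vmap]).
    - A concatenation of towers determines the list of towers, because each
      tower contains exactly one minimal path ([flatten_fib_inj]). Hence two
      edge sets that code the same map between the same levels are isomorphic
      ([codes_word]).
    - Let [alpha] be continuous, equivariant and send the maximal path to the
      maximal path. By compactness, for [l] large the prefix of length [l] of
      [x] determines the prefix of length [n] of [alpha x], and a maximal
      (minimal) prefix is sent to a maximal (minimal) one. Along a tower of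
      [C] the images then start with a minimal path, go from a path to its
      successor or from a maximal path to a minimal one, and end with a
      maximal path. They therefore run through a concatenation of towers of
      [B], and [alpha] has a code ([large_codes]).

    The codes of a pointed factor map, taken at an increasing sequence of
    levels, satisfy the commutation condition of a premorphism since both
    sides code the same map ([factor_premorphism]). Conversely a map that has
    codes at all levels commutes with the Vershik maps and preserves the
    maximal path, since [P] preserves the relation between the prefixes of a
    path and of its image under the Vershik map ([codes_equivariant]); the map
    of a premorphism is moreover continuous, and it is onto because its image
    is dense and compact ([Vmap_surj]).
    Finally [f] and [g] are equivalent exactly when [Vmap f] and [Vmap g]
    coincide ([pm_equivP]), again because codes are unique. *)

(** * Fibres and words of an ordered edge set *)

Section Fibre.
Variables (S T : finType) (F : edgeset S T).
Implicit Types (e f g : F) (t : T).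

(** The edges with range [t], in increasing order. *)
Definition fib t : seq F := sort ele (enum [pred e : F | rng e == t]).

(** The word over [S] that [F] attaches to [t]. *)
Definition word t : seq S := map src (fib t).

(** The relation between the prefixes, of a fixed length, of a path and of its
    image under the Vershik map: a prefix that is not maximal moves to its
    successor, and a maximal one to some minimal prefix. *)
Definition estep e f := if emaximal e then eminimal f else esucc e f.

Lemma mem_fib t e : (e \in fib t) = (rng e == t).
Proof. by rewrite mem_sort mem_enum. Qed.

Lemma fib_uniq t : uniq (fib t).
Proof. by rewrite sort_uniq enum_uniq. Qed.

Lemma elt_irr : irreflexive (@elt S T F).
Proof. by move=> e; rewrite /elt eqxx. Qed.

Lemma elt_trans : transitive (@elt S T F).
Proof.
move=> f e g /andP[nef ef] /andP[nfg fg]; rewrite /elt (ele_trans ef fg) andbT.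
apply: contraNneq nef => eg; subst g.
by apply/eqP/(@ele_anti _ _ F); rewrite ef fg.
Qed.

Lemma elt_asym e f : elt e f -> elt f e = false.
Proof. by move=> ef; apply/negP => /(elt_trans ef); rewrite elt_irr. Qed.

Lemma fib_pairwise t : pairwise elt (fib t).
Proof.
have -> : pairwise elt (fib t) =
    pairwise [rel x y | (x != y) && ele x y] (fib t) by [].
rewrite pairwise_relI -uniq_pairwise fib_uniq /=.
rewrite -(sorted_pairwise (@ele_trans _ _ F)).
apply: (@sort_sorted_in _ [pred e : F | rng e == t]).
  by move=> e f /eqP et /eqP ft; rewrite ele_comparable et ft.
by apply/allP => e; rewrite mem_enum.
Qed.

Lemma fib_charac t (s : seq F) :
  pairwise elt s -> s =i [pred e | rng e == t] -> fib t = s.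
Proof.
move=> ps ms; apply: (irr_sorted_eq elt_trans elt_irr).
- by rewrite (sorted_pairwise elt_trans) fib_pairwise.
- by rewrite (sorted_pairwise elt_trans).
- by move=> e; rewrite mem_fib ms.
Qed.

(** The position of [e] in its fibre decides whether [e] is maximal or minimal,
    and what its successor is. *)
Section Split.
Variables (t : T) (s1 s2 : seq F) (e : F).
Hypothesis fibE : fib t = s1 ++ e :: s2.

Lemma split_lt f : (f \in s1) = elt f e.
Proof.
have := fib_pairwise t; rewrite fibE pairwise_cat => /and3P[/allrelP s12 _].
rewrite /= => /andP[/allP s2e _].
apply/idP/idP => [fs1|fe]; first by apply: s12; rewrite ?mem_head.
have : f \in fib t.
  by rewrite mem_fib (elt_rng fe) -mem_fib fibE mem_cat mem_head orbT.
rewrite fibE mem_cat inE => /or3P[//|/eqP fe'|/s2e]; last by rewrite elt_asym.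
by rewrite fe' elt_irr in fe.
Qed.

Lemma split_gt f : (f \in s2) = elt e f.
Proof.
have := fib_pairwise t; rewrite fibE pairwise_cat => /and3P[/allrelP s12 _].
rewrite /= => /andP[/allP s2e _].
apply/idP/idP => [/s2e//|ef].
have : f \in fib t.
  by rewrite mem_fib -(elt_rng ef) -mem_fib fibE mem_cat mem_head orbT.
rewrite fibE mem_cat inE => /or3P[fs1|/eqP fe'|//].
  by have := s12 _ _ fs1 (mem_head _ _); rewrite elt_asym.
by rewrite fe' elt_irr in ef.
Qed.

Lemma split_emaximal : emaximal e = nilp s2.
Proof.
apply/forallP/nilP => [emax|s20 f]; last first.
  apply/implyP => ef; apply: contraT => nfe.
  by have := split_gt f; rewrite s20 /elt eq_sym nfe ef.
case: s2 split_gt => // f s split; have := split f.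
rewrite mem_head /elt => /esym/andP[/negPf nef ef].
by have := emax f; rewrite ef eq_sym nef.
Qed.

Lemma split_eminimal : eminimal e = nilp s1.
Proof.
apply/forallP/nilP => [emin|s10 f]; last first.
  apply/implyP => ef; apply: contraT => nfe.
  by have := split_lt f; rewrite s10 /elt nfe ef.
case: s1 split_lt => // f s split; have := split f.
rewrite mem_head /elt => /esym/andP[/negPf nef ef].
by have := emin f; rewrite ef nef.
Qed.

Lemma split_esucc f : esucc e f = (ohead s2 == Some f).
Proof.
rewrite /esucc -split_gt; have := fib_pairwise t.
rewrite fibE pairwise_cat => /and3P[_ _ /=/andP[_]].
case: s2 split_gt => [//|g s] split /= /andP[/allP gs _].
apply/andP/eqP => [[fs /forallP fl]|[<-]].
  move: fs; rewrite inE => /predU1P[->//|/gs /andP[ngf gf]].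
  have := fl g; rewrite -split mem_head /= => fg.
  by congr Some; apply/(@ele_anti _ _ F); rewrite gf fg.
rewrite mem_head; split=> //; apply/forallP => h; apply/implyP.
by rewrite -split inE => /predU1P[->|/gs/andP[]//]; rewrite ele_refl.
Qed.

End Split.

Lemma fib_split e : exists s1 s2, fib (rng e) = s1 ++ e :: s2.
Proof.
have : e \in fib (rng e) by rewrite mem_fib.
by case/splitPr => s1 s2; exists s1, s2.
Qed.

Lemma esucc_inj e f f' : esucc e f -> esucc e f' -> f = f'.
Proof.
have [s1 [s2 E]] := fib_split e.
by rewrite !(split_esucc E) => /eqP-> /eqP[].
Qed.

Lemma esucc_nmax e f : esucc e f -> ~~ emaximal e.
Proof.
have [s1 [s2 E]] := fib_split e.
by rewrite (split_esucc E) (split_emaximal E); case: s2 {E}.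
Qed.

Lemma fib_head t e s : fib t = e :: s -> eminimal e.
Proof. by move=> E; rewrite (@split_eminimal t [::] s). Qed.

Lemma fib_last t e s : fib t = e :: s -> emaximal (last e s).
Proof.
case: (lastP s) => [|s' f] E /=.
  by rewrite (@split_emaximal t [::] [::]).
by rewrite last_rcons (@split_emaximal t (e :: s') [::])// -cat_rcons cats0.
Qed.

Lemma fib_path t e s : fib t = e :: s -> path esucc e s.
Proof.
move=> E; have : fib t = [::] ++ e :: s by [].
elim: s [::] e {E} => // f s IH s1 e E /=.
by rewrite (split_esucc E) eqxx (IH (rcons s1 e)) // cat_rcons.
Qed.

(** A sequence of edges that moves by [estep] and stops at a maximal edge
    consists of the end of the fibre of its first edge [e], followed by whole
    fibres. *)
Lemma estep_path_flatten e s : path estep e s -> emaximal (last e s) ->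
  exists ts, e :: s = drop (index e (fib (rng e))) (fib (rng e))
                      ++ flatten (map fib ts).
Proof.
have dropE f : exists s1 s2, fib (rng f) = s1 ++ f :: s2 /\
    drop (index f (fib (rng f))) (fib (rng f)) = f :: s2.
  have [s1 [s2 E]] := fib_split f; exists s1, s2; split=> //.
  have := fib_uniq (rng f); rewrite {1}E uniq_catC /= mem_cat.
  case/andP => /norP[_ nfs1] _.
  by rewrite E index_cat (negPf nfs1) /= eqxx addn0 drop_size_cat.
elim: s e => [|f s IH] e /=.
  move=> _ emax; have [s1 [s2 [E ->]]] := dropE e; exists [::].
  by move: emax; rewrite (split_emaximal E) => /nilP->.
case/andP => ef /IH{}IH /IH[ts ->].
have [s1 [s2 [E ->]]] := dropE e; have [u1 [u2 [E' ->]]] := dropE f.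
move: ef; rewrite /estep (split_emaximal E); case: nilP => [->|_].
  rewrite (split_eminimal E') => /nilP u10; subst u1.
  by exists (rng f :: ts); rewrite /= E'.
move=> ef; have rfe : rng e = rng f by apply: elt_rng; case/andP: ef.
move: ef; rewrite (split_esucc E) => /eqP s2f.
exists ts; congr (_ :: _); congr (_ ++ _).
case: s2 E s2f => //= g s2 E [gf]; subst g; congr (_ :: _).
have := fib_uniq (rng e); rewrite E -cat_rcons => us.
have := E'; rewrite -rfe E -cat_rcons => /eqP.
have sz : size (rcons s1 e) = size u1.
  have := congr1 (index f) E'; rewrite -rfe E -cat_rcons !index_cat /= eqxx.
  move: us; rewrite uniq_catC /= mem_cat => /andP[/norP[_ /negPf->] _].
  have := fib_uniq (rng f); rewrite E' uniq_catC /= mem_cat.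
  by move=> /andP[/norP[_ /negPf->] _]; rewrite !addn0.
by rewrite eqseq_cat // => /andP[_ /eqP[->]].
Qed.

(** Conversely, a concatenation of non-empty fibres that comes after a maximal
    edge moves by [estep] and stops at a maximal edge. *)
Lemma path_flatten_estep ts e : (forall t, fib t != [::]) -> emaximal e ->
  path estep e (flatten (map fib ts)) /\
  emaximal (last e (flatten (map fib ts))).
Proof.
move=> fib0; elim: ts e => // t ts IH e emax /=.
case E : (fib t) (fib0 t) => [//|f s] _.
have [IH1 IH2] := IH _ (fib_last E); rewrite /= cat_path last_cat IH1 IH2.
split=> //; rewrite andbT {1}/estep emax (fib_head E) /=.
apply: sub_path (fib_path E) => g h gh.
by rewrite /estep (negPf (esucc_nmax gh)).
Qed.

(** A concatenation of non-empty fibres determines the fibres, since each of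
    them contains exactly one minimal edge. *)
Lemma flatten_fib_inj : (forall t, fib t != [::]) ->
  injective (fun ts => flatten (map fib ts)).
Proof.
move=> fib0 ts us; pose dec (s : seq F) := map rng [seq e <- s | eminimal e].
suff decK vs : dec (flatten (map fib vs)) = vs.
  by move=> E; rewrite -(decK ts) E.
elim: vs => // t vs IH; rewrite /dec /= filter_cat map_cat [X in _ ++ X]IH.
case E : (fib t) (fib0 t) => [//|f s] _; rewrite /= (fib_head E) /=.
have /eqP -> : rng f == t by rewrite -mem_fib E mem_head.
suff -> : [seq e <- s | eminimal e] = [::] by [].
apply/eqP; rewrite -(negbK (_ == _)) -has_filter; apply/hasPn => g gs.
have gt : elt f g by rewrite -(@split_gt t [::] s).
have [s1 [s2 E']] := fib_split g.
rewrite (split_eminimal E'); apply/nilP => s10.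
by have := split_lt E' f; rewrite gt s10.
Qed.

(** The order is recovered from the positions in the fibres. *)
Lemma eleE e f : ele e f = (rng e == rng f) &&
  (index e (fib (rng e)) <= index f (fib (rng f))).
Proof.
have [rr|nr] := eqVneq (rng e) (rng f); last first.
  by apply/negP => ef; move: nr; rewrite -ele_comparable ef.
have [s1 [s2 E]] := fib_split e; have uf := fib_uniq (rng e).
rewrite /= -rr E index_cat.
have -> : (e \in s1) = false by rewrite (split_lt E) elt_irr.
rewrite /= eqxx addn0 index_cat (split_lt E); have [fe|nfe] := boolP (elt f e).
  have -> : ele e f = false.
    apply/negP => ef; case/andP: fe => nfe fe.
    by move/negP: nfe; apply; apply/eqP/(@ele_anti _ _ F); rewrite fe ef.
  apply/esym/negbTE; rewrite -ltnNge; rewrite -(split_lt E) in fe.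
  by rewrite index_mem.
rewrite leq_addr; have := ele_comparable e f; rewrite rr eqxx.
case/orP => // fe; move: nfe; rewrite /elt fe andbT negbK => /eqP->.
exact: ele_refl.
Qed.

End Fibre.

Arguments estep {S T F} e f.

(** A bijection between edge sets that preserves ranges and order. Sources are
    not compared, and may even lie in different sets. *)
Definition oiso (S S' T : finType) (F : edgeset S T) (F' : edgeset S' T)
    (h : F -> F') :=
  [/\ bijective h, forall e, rng (h e) = rng e
    & forall e e', ele (h e) (h e') = ele e e'].

Lemma eiso_oiso (S T : finType) (F F' : edgeset S T) (h : F -> F') :
  is_eiso h -> oiso h.
Proof. by case. Qed.

Lemma map_oiso_fib (S S' T : finType) (F : edgeset S T) (F' : edgeset S' T)
    (h : F -> F') t : oiso h -> map h (fib F t) = fib F' t.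
Proof.
move=> [bh hr hl]; have ih := bij_inj bh; apply/esym/fib_charac.
  rewrite pairwise_map; apply: etrans (fib_pairwise F t); apply: eq_pairwise.
  by move=> e e'; rewrite /elt /= hl (inj_eq ih).
case: bh => h' hK h'K e; rewrite inE -{1}[e]h'K mem_map // mem_fib.
by rewrite -hr h'K.
Qed.

Lemma eiso_word (S T : finType) (F F' : edgeset S T) :
  eiso F F' -> word F =1 word F'.
Proof.
move=> [h ih] t; rewrite /word -(map_oiso_fib t (eiso_oiso ih)) -map_comp.
by case: ih => _ hs _ _; apply: eq_map => e; rewrite /= hs.
Qed.

(** The isomorphism matches the edges that have the same range and the same
    position in their fibre. *)
Lemma word_eiso (S T : finType) (F F' : edgeset S T) :
  word F =1 word F' -> eiso F F'.
Proof.
move=> FF'.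
have ex (G G' : edgeset S T) : word G =1 word G' -> forall e : G,
    exists e' : G', [/\ src e' = src e, rng e' = rng e
      & index e' (fib G' (rng e')) = index e (fib G (rng e))].
  move=> GG' e; have /(congr1 size) := GG' (rng e); rewrite !size_map => sz.
  have ie : index e (fib G (rng e)) < size (fib G' (rng e)).
    by rewrite -sz index_mem mem_fib.
  have [e0 _] : exists e0 : G', true.
    by move: ie; case: (fib G' _) => // e0; exists e0.
  set e' := nth e0 (fib G' (rng e)) (index e (fib G (rng e))).
  have re' : rng e' = rng e by apply/eqP; rewrite -mem_fib mem_nth.
  exists e'; split=> //; last by rewrite re' index_uniq // fib_uniq.
  rewrite /e' -(nth_map e0 (src e0)) //; have := GG' (rng e).
  rewrite /word => <-; rewrite (nth_map e) ?index_mem ?mem_fib //.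
  by rewrite nth_index // mem_fib.
have inj (G : edgeset S T) (e e' : G) : rng e = rng e' ->
    index e (fib G (rng e)) = index e' (fib G (rng e')) -> e = e'.
  move=> r i; rewrite -(nth_index e (_ : e \in fib G (rng e))) ?mem_fib //.
  by rewrite i r nth_index // mem_fib.
have [h hP] := choice (ex _ _ FF').
have [k kP] := choice (ex _ _ (fsym FF')).
exists h; split.
- exists k => e.
    have [_ r1 i1] := kP (h e); have [_ r2 i2] := hP e.
    by apply: inj; [rewrite r1 r2|rewrite i1 i2].
  have [_ r1 i1] := hP (k e); have [_ r2 i2] := kP e.
  by apply: inj; [rewrite r1 r2|rewrite i1 i2].
- by move=> e; have [] := hP e.
- by move=> e; have [] := hP e.
- move=> e e'; rewrite !eleE; have [_ r1 i1] := hP e.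
  by have [_ r2 i2] := hP e'; rewrite i1 i2 r1 r2.
Qed.

(** * Composition of edge sets *)

Section FibComp.
Variables (S T U : finType) (F : edgeset S T) (G : edgeset T U).

Lemma fib_ecomp u : map val (fib (ecomp F G) u) =
  flatten [seq [seq (e, g) | e <- fib F (src g)] | g <- fib G u].
Proof.
pose lexlt (p q : F * G) := elt p.2 q.2 || (p.2 == q.2) && elt p.1 q.1.
have lexlt_val (p q : ecomp F G) : elt p q = lexlt (val p) (val q).
  case: p q => [[e g] eg] [[e' g'] e'g'].
  rewrite /elt /lexlt /= /comp_le -val_eqE /= /elt -pair_eqE /=.
  by have [->|] := eqVneq g g'; rewrite ?andbT ?andbF ?orbF.
have lexlt_irr : irreflexive lexlt.
  by move=> p; rewrite /lexlt !elt_irr andbF.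
have lexlt_trans : transitive lexlt.
  move=> [e g] [e1 g1] [e2 g2]; rewrite /lexlt /=.
  case/orP => [l1|/andP[/eqP<- l1]]; case/orP => [l2|/andP[/eqP<- l2]].
  - by rewrite (elt_trans l1 l2).
  - by rewrite l1.
  - by rewrite l2.
  - by rewrite eqxx (elt_trans l1 l2) orbT.
apply: (irr_sorted_eq lexlt_trans lexlt_irr).
- rewrite (sorted_pairwise lexlt_trans) pairwise_map.
  apply: etrans (fib_pairwise (ecomp F G) u); apply: eq_pairwise => p q /=.
  by rewrite lexlt_val.
- rewrite (sorted_pairwise lexlt_trans); have := fib_pairwise G u.
  elim: (fib G u) => //= g s IH /andP[/allP gs /IH{}IH].
  rewrite pairwise_cat IH andbT; apply/andP; split.
    apply/allrelP => p q /mapP[e _ ->{p}] /flatten_mapP[g' g's /mapP[e' _ ->]].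
    by rewrite /lexlt gs.
  rewrite pairwise_map; apply: etrans (fib_pairwise F (src g)).
  by apply: eq_pairwise => e e'; rewrite /lexlt /= elt_irr eqxx.
- move=> [e g]; apply/mapP/flatten_mapP => [[p pu ->]|[g']].
    have {}pu : rng (val p).2 == u.
      exact: (etrans (esym (@mem_fib _ _ (ecomp F G) u p)) pu).
    exists (val p).2; first by rewrite mem_fib.
    apply/mapP; exists (val p).1; last exact: surjective_pairing.
    by rewrite mem_fib; exact: valP p.
  rewrite mem_fib => g'u /mapP[e' /[!mem_fib] e'g' [-> ->]].
  exists (exist _ (e', g') e'g' : ecomp F G) => //.
  exact: (etrans (@mem_fib _ _ (ecomp F G) u (exist _ (e', g') e'g')) g'u).
Qed.

Lemma fib_ecomp_fst u : map (fun p : ecomp F G => (val p).1) (fib (ecomp F G) u)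
  = flatten (map (fib F) (word G u)).
Proof.
transitivity (map fst (map val (fib (ecomp F G) u))).
  by rewrite -map_comp.
rewrite fib_ecomp map_flatten -map_comp /word -map_comp.
congr flatten; apply: eq_map => g /=; rewrite -map_comp.
exact: map_id.
Qed.

Lemma word_ecomp u : word (ecomp F G) u = flatten (map (word F) (word G u)).
Proof.
transitivity (map src
  (map (fun p : ecomp F G => (val p).1) (fib (ecomp F G) u))).
  by rewrite -map_comp.
by rewrite fib_ecomp_fst map_flatten -map_comp.
Qed.

Hypothesis F_surj : forall t, exists e : F, rng e = t.

Lemma emaximal_ecomp (p : ecomp F G) :
  emaximal p = emaximal (val p).1 && emaximal (val p).2.
Proof.
case: p => [[e g] eg] /=; apply/forallP/andP => [pmax|].
  split; apply/forallP => g'; apply/implyP => le.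
    have g'g : rng g' == src g.
      by rewrite -(eqP eg) /= eq_sym -ele_comparable le.
    have := pmax (exist _ (g', g) g'g).
    by rewrite /= /comp_le /= eqxx le orbT -val_eqE /= -pair_eqE /= => /andP[].
  have [e' e'g'] := F_surj (src g'); move/eqP in e'g'.
  have := pmax (exist _ (e', g') e'g').
  rewrite /= /comp_le /elt /= le andbT -val_eqE /= -pair_eqE /= (eq_sym g).
  by have [//|] := eqVneq g' g; rewrite andbF.
move=> [/forallP emax /forallP gmax] [[e' g'] e'g'].
apply/implyP; rewrite /= /comp_le /= /elt -val_eqE /= -pair_eqE /=.
case/orP => [/andP[ng lg]|/andP[/eqP-> le]].
  by have := gmax g'; rewrite lg eq_sym (negPf ng).
by have := emax e'; rewrite le eqxx => /= ->.
Qed.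

Lemma eminimal_ecomp (p : ecomp F G) :
  eminimal p = eminimal (val p).1 && eminimal (val p).2.
Proof.
case: p => [[e g] eg] /=; apply/forallP/andP => [pmax|].
  split; apply/forallP => g'; apply/implyP => le.
    have g'g : rng g' == src g.
      by rewrite -(eqP eg) /= -ele_comparable le.
    have := pmax (exist _ (g', g) g'g).
    by rewrite /= /comp_le /= eqxx le orbT -val_eqE /= -pair_eqE /= => /andP[].
  have [e' e'g'] := F_surj (src g'); move/eqP in e'g'.
  have := pmax (exist _ (e', g') e'g').
  rewrite /= /comp_le /elt /= le andbT -val_eqE /= -pair_eqE /=.
  by have [//|] := eqVneq g' g; rewrite andbF.
move=> [/forallP emin /forallP gmin] [[e' g'] e'g'].
apply/implyP; rewrite /= /comp_le /= /elt -val_eqE /= -pair_eqE /=.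
case/orP => [/andP[ng lg]|/andP[/eqP-> le]].
  by have := gmin g'; rewrite lg (negPf ng).
by have := emin e'; rewrite le eqxx => /= ->.
Qed.

(** The successor of a composite edge changes the first component only, as long
    as that component is not maximal; otherwise it changes the second one and
    starts again from a minimal first component. *)
Lemma esucc_ecomp_low (p q : ecomp F G) : (val p).2 = (val q).2 ->
  esucc (val p).1 (val q).1 -> esucc p q.
Proof.
case: p q => [[e g] eg] [[e' g'] e'g'] /= gg'; subst g'.
case/andP=> ee' /forallP emin; rewrite /esucc; apply/andP; split.
  rewrite /elt -val_eqE /= /comp_le /= -pair_eqE /= eqxx andbT.
  by case/andP: ee' => -> ->; rewrite orbT.
apply/forallP => [[[e1 g1] eg1]]; apply/implyP.
rewrite /elt -val_eqE /= /comp_le /= -pair_eqE /= => /andP[np].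
case/orP => [->//|/andP[/eqP g1E le]]; subst g1; rewrite eqxx andbT in np.
have /implyP := emin e1; rewrite /elt np le => -> //.
by rewrite eqxx orbT.
Qed.

Lemma esucc_ecomp_high (p q : ecomp F G) : emaximal (val p).1 ->
  eminimal (val q).1 -> esucc (val p).2 (val q).2 -> esucc p q.
Proof.
case: p q => [[e g] eg] [[e' g'] e'g'] /= emax emin.
case/andP=> gg' /forallP gmin; rewrite /esucc; apply/andP; split.
  rewrite /elt -val_eqE /= /comp_le /= -pair_eqE /= gg' andbT.
  by case/andP: gg' => /negPf->; rewrite andbF.
apply/forallP => [[[e1 g1] eg1]]; apply/implyP.
rewrite /elt -val_eqE /= /comp_le /= -pair_eqE /= => /andP[np].
case/orP => [lg|/andP[/eqP g1E le]]; last first.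
  subst g1; have := forallP emax e1; rewrite le /= => /eqP e1E.
  by rewrite e1E !eqxx in np.
have /implyP/(_ lg) le := gmin g1; rewrite /elt le andbT.
have [g1E|//] := eqVneq g' g1; subst g1.
have := ele_comparable e' e1; rewrite (eqP e'g') (eqP eg1) eqxx.
case/orP => [//|l1]; have := forallP emin e1; rewrite l1 => /eqP->.
exact: ele_refl.
Qed.

End FibComp.

(** * The edge set with prescribed words *)

Section EdgesOfWords.
Variables (S T : finType) (V : T -> seq S).

(** An edge with range [t] is a position in the word [V t]; its source is the
    letter in that position. *)
Definition wedge : finType := {t : T & 'I_(size (V t))}.

Definition wsrc (e : wedge) : S := tnth (in_tuple (V (tag e))) (tagged e).

Definition wle (e e' : wedge) := (tag e == tag e') && (tagged e <= tagged e').

Let wle_refl : reflexive wle.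
Proof. by move=> e; rewrite /wle eqxx leqnn. Qed.

Let wedge_inj (e e' : wedge) :
  tag e = tag e' -> tagged e = tagged e' :> nat -> e = e'.
Proof.
case: e e' => [t i] [t' i'] /= tt'; subst t' => /= ii'.
by congr existT; exact: val_inj.
Qed.

Let wle_anti : antisymmetric wle.
Proof.
move=> e e' /andP[/andP[/eqP tt' l] /andP[_ l']]; apply: wedge_inj => //.
by apply/eqP; rewrite eqn_leq l l'.
Qed.

Let wle_trans : transitive wle.
Proof.
move=> e e1 e2 /andP[/eqP t1 l1] /andP[/eqP t2 l2].
by apply/andP; split; [rewrite t1 t2|exact: leq_trans l1 l2].
Qed.

Let wle_comparable e e' : wle e e' || wle e' e = (tag e == tag e').
Proof. by rewrite /wle (eq_sym (tag e')) -andb_orr leq_total andbT. Qed.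

(** The edge set whose word at [t] is [V t]. *)
Definition wedgeset : edgeset S T :=
  @EdgeSet S T wedge wsrc (@tag _ _) wle wle_refl wle_anti wle_trans
    wle_comparable.

Lemma word_wedgeset : word wedgeset =1 V.
Proof.
move=> t.
have -> : word wedgeset t =
    map src [seq (Tagged (fun t => 'I_(size (V t))) i : wedgeset)
            | i <- enum 'I_(size (V t))].
  congr map; apply: fib_charac.
    rewrite pairwise_map; have : pairwise ltn (map val (enum 'I_(size (V t)))).
      rewrite val_enum_ord -(sorted_pairwise ltn_trans).
      exact: iota_ltn_sorted.
    rewrite pairwise_map; apply: sub_pairwise => i j /= ij.
    apply/andP; split; last by rewrite /= /wle /= eqxx ltnW.
    apply/eqP => /(congr1 (fun e : wedge => nat_of_ord (tagged e))) /= E.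
    by rewrite E ltnn in ij.
  move=> [t' i]; rewrite inE /=; apply/mapP/eqP => [[j _ E]|tt'].
    exact: (congr1 (fun e : wedge => tag e) E).
  by subst t'; exists i; rewrite ?mem_enum.
rewrite -map_comp -[RHS](map_tnth_enum (in_tuple (V t))).
by apply: eq_map => i.
Qed.

End EdgesOfWords.

(** * Finite prefixes of infinite paths *)

Section Prefixes.
Variable B : obratteli.
Implicit Types (x y z : bpath B) (n k l : nat).

(** [lpath n] is E_{0,n}. It ends in [bV B n] itself, whereas the range of
    [epath B 0 n] is in [bV B (n + 0)]. *)
Fixpoint lpath n : edgeset (bV B 0) (bV B n) :=
  if n is n'.+1 then ecomp (lpath n') (bE B n') else eid (bV B 0).

(** The prefix of length [n] of [x], with the proof that the edge [x n] can be
    appended to it. *)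
Fixpoint pre_sub x n : {p : lpath n | rng p == src (x n)} :=
  match n with
  | 0 => exist _ (src (x 0) : lpath 0) (eqxx _)
  | n'.+1 =>
      exist _ (exist _ (val (pre_sub x n'), x n') (valP (pre_sub x n'))
                 : lpath n'.+1) (introT eqP (bpathP x n'))
  end.

(** The prefix of length [n] of [x]. *)
Definition pre x n : lpath n := val (pre_sub x n).

Lemma lpath_surj n (v : bV B n) : exists p : lpath n, rng p = v.
Proof.
elim: n v => [|n IH] v; first by exists v.
have [e ev] := brng_surj v; have [p /eqP pe] := IH (src e).
by exists (exist _ (p, e) pe : lpath n.+1).
Qed.

Lemma fib_lpath_neq0 n (v : bV B n) : fib (lpath n) v != [::].
Proof.
have [p /eqP pv] := lpath_surj v.
by apply/eqP => E; move: pv; rewrite -mem_fib E.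
Qed.

Lemma lpath0 (p q : lpath 0) : p = q.
Proof.
have /card_le1_eqP H : #|bV B 0| <= 1 by rewrite bV0.
exact: H.
Qed.

Lemma bpath_eq x y : (forall n, x n = y n) -> x = y.
Proof.
case: x y => [x xP] [y yP] /= xy.
have E : x = y by apply: functional_extensionality_dep.
by subst y; rewrite (Prop_irrelevance xP yP).
Qed.

Lemma eq_preP x y n : pre x n = pre y n <-> forall i, i < n -> x i = y i.
Proof.
elim: n => [|n [IH1 IH2]].
  by split=> [//|_]; exact: lpath0.
split=> [E i|E].
  have E1 := congr1 (fun p : lpath n.+1 => (val p).1) E.
  have E2 := congr1 (fun p : lpath n.+1 => (val p).2) E.
  by rewrite ltnS leq_eqVlt => /predU1P[->//|]; exact: IH1.
apply: val_inj; congr (_, _); last exact: E.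
by apply: IH2 => i /ltnW; exact: E.
Qed.

Lemma eq_pre_le x y n k : k <= n -> pre x n = pre y n -> pre x k = pre y k.
Proof.
move=> kn /eq_preP E; apply/eq_preP => i ik; exact: E (leq_trans ik kn).
Qed.

Lemma pre_inj x y : (forall N, exists2 n, N <= n & pre x n = pre y n) -> x = y.
Proof.
move=> E; apply: bpath_eq => n; have [m nm /eq_preP] := E n.+1.
exact.
Qed.

Lemma emaximal_pre x n :
  emaximal (pre x n) <-> forall i, i < n -> emaximal (x i).
Proof.
elim: n => [|n [IH1 IH2]].
  split=> // _; apply/forallP => p.
  by rewrite (lpath0 p (pre x 0)) eqxx implybT.
rewrite (emaximal_ecomp (@lpath_surj n)); split=> [/andP[/IH1 E1 E2] i|E].
  by rewrite ltnS leq_eqVlt => /predU1P[->//|/E1].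
by rewrite E // andbT; apply: IH2 => i /ltnW /E.
Qed.

Lemma eminimal_pre x n :
  eminimal (pre x n) <-> forall i, i < n -> eminimal (x i).
Proof.
elim: n => [|n [IH1 IH2]].
  split=> // _; apply/forallP => p.
  by rewrite (lpath0 p (pre x 0)) eqxx implybT.
rewrite (eminimal_ecomp (@lpath_surj n)); split=> [/andP[/IH1 E1 E2] i|E].
  by rewrite ltnS leq_eqVlt => /predU1P[->//|/E1].
by rewrite E // andbT; apply: IH2 => i /ltnW /E.
Qed.

(** Every vertex of level [k] is the source of an infinite path. The values of
    [z] below level [k] are irrelevant. *)
Lemma ex_tail k (v : bV B k) : exists z : forall n, bE B n,
  (forall i, k <= i -> rng (z i) = src (z i.+1)) /\ src (z k) = v.
Proof.
pose nx n := @choice _ _ (fun w e => src e = w) (@bsrc_surj B n).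
pose g n := projT1 (nx n).
have gP n w : src (g n w) = w := projT2 (nx n) w.
pose fix u d : bE B (d + k) :=
  if d is d'.+1 then g _ (rng (u d')) else g _ v.
have uS d : rng (u d) = src (u d.+1) by rewrite /= gP.
(* [u d] lies in [bE B (d + k)]; transport along [d + k = n] turns [u] into
   a function of the level [n]. *)
have ez n : exists e : bE B n, forall d (E : d + k = n),
    e = ecast i (edge (bE B i)) E (u d).
  have [kn|nk] := leqP k n; last first.
    have [e _] : exists e : bE B n, true.
      by have /card_gt0P[e _] := bE_neq0 B n; exists e.
    exists e => d E; suff : k <= n by rewrite leqNgt nk.
    by rewrite -E leq_addl.
  have [d dE] : exists d, n = d + k by exists (n - k); rewrite subnK.
  subst n; exists (u d) => d' E.
  have dd : d' = d by apply/eqP; rewrite -(eqn_add2r k) E.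
  by subst d'; rewrite (eq_irrelevance E erefl).
pose z n := sval (cid (ez n)).
have zE d : z (d + k) = u d := svalP (cid (ez (d + k))) d erefl.
exists z; split; last by rewrite (zE 0) /= gP.
move=> i ki; have [d dE] : exists d, i = d + k by exists (i - k); rewrite subnK.
by subst i; rewrite zE (zE d.+1) uS.
Qed.

Lemma ex_bpath l (p : lpath l) : exists x, pre x l = p.
Proof.
have [z [zP zl]] := ex_tail (rng p).
suff [x [xp _]] : exists x, pre x l = p /\ forall i, l <= i -> x i = z i.
  by exists x.
elim: l p z zP zl => [|l IH] p z zP zl.
  by exists (BPath (fun i => zP i isT)); split=> //; exact: lpath0.
case: p zl => -[p e] pe /= zl.
have [||x [xp xz]] := IH p (dfwith z e).
- move=> i; rewrite leq_eqVlt => /orP[/eqP <-|ki].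
    by rewrite dfwith_in dfwith_out // neq_ltn ltnSn.
  by rewrite !dfwith_out ?zP // neq_ltn ?ki // ltnS ltnW.
- by rewrite dfwith_in (eqP pe).
exists x; split.
  have xl : x l = e by rewrite xz // dfwith_in.
  by apply: val_inj; exact: (congr2 pair xp xl).
by move=> i li; rewrite xz ?(ltnW li)// dfwith_out // neq_ltn li.
Qed.

End Prefixes.

Arguments lpath : clear implicits.

(** * The Vershik map on prefixes *)

Section VershikPrefix.
Variable B : pobratteli.
Implicit Types (x y : bpath B).

Lemma xmaxP : max_path (xmax B).
Proof. exact/max_pathE. Qed.

Lemma min_pathE x : min_path x <-> x = xmin B.
Proof.
have [Hm Hu] := svalP (cid (po_min B)).
by split=> [/Hu|->]; [move=> <-|].
Qed.

Lemma xminP : min_path (xmin B).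
Proof. exact/min_pathE. Qed.

Lemma vershik_step_esucc x y k l : vershik_step x y k -> k < l ->
  esucc (pre x l) (pre y l).
Proof.
move=> [xmx _ xy ymn xyk]; elim: l => // l IH.
rewrite ltnS leq_eqVlt => /predU1P[<-|kl].
  apply: esucc_ecomp_high => //=.
    exact/emaximal_pre.
  exact/eminimal_pre.
apply: esucc_ecomp_low; last exact: IH.
by rewrite /= xyk.
Qed.

Lemma vershik_estep x n : estep (pre x n) (pre (vershik x) n).
Proof.
rewrite /estep; case: (vershikP x) => [[-> ->]|[k step]].
  have /emaximal_pre-> : forall i, i < n -> emaximal (xmax B i).
    by move=> i _; exact: xmaxP.
  by apply/eminimal_pre => i _; exact: xminP.
have [kn|nk] := ltnP k n.
  by have := vershik_step_esucc step kn => /[dup]/esucc_nmax/negPf-> ->.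
case: step => xmx _ _ ymn _.
have /emaximal_pre-> : forall i, i < n -> emaximal (x i).
  by move=> i ik; apply: xmx; exact: leq_trans nk.
by apply/eminimal_pre => i ik; apply: ymn; exact: leq_trans nk.
Qed.

(** The relations [estep] between the prefixes characterise the Vershik map: if
    [x] is not the maximal path, its long prefixes are not maximal and have
    only one successor. *)
Lemma estep_vershik x y :
  (forall n, estep (pre x n) (pre y n)) -> y = vershik x.
Proof.
move=> xy; have [xm|nmax] := pselect (max_path x).
  have ex n : emaximal (pre x n) by apply/emaximal_pre => i _; exact: xm.
  have -> : vershik x = xmin B.
    apply/min_pathE => n; have := vershik_estep x n.+1.
    by rewrite /estep ex => /eminimal_pre; exact.
  apply/min_pathE => n; have := xy n.+1.
  by rewrite /estep ex => /eminimal_pre; exact.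
have [k nk] : exists k, ~~ emaximal (x k).
  apply: contrapT => nk; apply: nmax => n; apply: contrapT => /negP xn.
  by apply: nk; exists n.
apply: pre_inj => N; exists (maxn N k.+1); first exact: leq_maxl.
set n := maxn N k.+1; have kn : k < n by exact: leq_maxr.
have /negPf nm : ~~ emaximal (pre x n).
  by apply: contra nk => /emaximal_pre; exact.
have := xy n; have := vershik_estep x n; rewrite /estep nm => E E'.
exact: esucc_inj E' E.
Qed.

Lemma vershik_xmax : vershik (xmax B) = xmin B.
Proof.
apply/min_pathE => n; have := vershik_estep (xmax B) n.+1; rewrite /estep.
have /emaximal_pre-> : forall i, i < n.+1 -> emaximal (xmax B i).
  by move=> i _; exact: xmaxP.
by move/eminimal_pre; exact.
Qed.

End VershikPrefix.

(** * Coding a map by an edge set *)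

(** [F] codes [alpha]: a map [P] on finite paths computes the prefixes of
    length [n] of [alpha x] from the prefixes of length [l] of [x], and maps the
    tower of each vertex [w] onto the concatenation of the towers of the letters
    of the word of [F] at [w]. *)
Definition codes (B C : obratteli) (alpha : bpath C -> bpath B) n l
    (F : edgeset (bV B n) (bV C l)) :=
  exists P : lpath C l -> lpath B n,
    (forall x, pre (alpha x) n = P (pre x l)) /\
    (forall w, map P (fib (lpath C l) w) =
               flatten (map (fib (lpath B n)) (word F w))).

(** Edge sets with the same words code maps with the same prefixes. *)
Lemma codes_eq_pre (B C : obratteli) (alpha beta : bpath C -> bpath B) n l
    (F G : edgeset (bV B n) (bV C l)) :
  codes alpha F -> codes beta G -> word F =1 word G ->
  forall x, pre (alpha x) n = pre (beta x) n.
Proof.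
move=> [P [aP PF]] [Q [bQ QG]] FG x; rewrite aP bQ.
have /eq_in_map : map P (fib (lpath C l) (rng (pre x l))) =
    map Q (fib (lpath C l) (rng (pre x l))) by rewrite PF QG FG.
by apply; rewrite mem_fib.
Qed.

(** Uniqueness of the code: the word at [w] is read off from the image of the
    tower of [w]. *)
Lemma codes_word (B C : obratteli) (alpha beta : bpath C -> bpath B) n l
    (F G : edgeset (bV B n) (bV C l)) :
  codes alpha F -> codes beta G ->
  (forall x, pre (alpha x) n = pre (beta x) n) -> word F =1 word G.
Proof.
move=> [P [aP PF]] [Q [bQ QG]] ab w.
apply: (flatten_fib_inj (@fib_lpath_neq0 B n)) => /=.
rewrite -PF -QG; apply: eq_map => p; have [x <-] := ex_bpath p.
by rewrite -aP -bQ.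
Qed.

Lemma codes_eiso (B C : obratteli) (alpha : bpath C -> bpath B) n l
    (F G : edgeset (bV B n) (bV C l)) :
  eiso F G -> codes alpha F -> codes alpha G.
Proof.
move=> /eiso_word FG [P [aP PF]]; exists P; split=> // w.
by rewrite PF FG.
Qed.

Lemma flatten_flatten (T : Type) (s : seq (seq (seq T))) :
  flatten (flatten s) = flatten (map flatten s).
Proof. by elim: s => //= t s IH; rewrite flatten_cat IH. Qed.

Lemma fib_eid (S : finType) (v : S) : fib (eid S) v = [:: v].
Proof. by apply: fib_charac => // u; rewrite !inE. Qed.

Lemma codes_comp (A B C : obratteli) (alpha : bpath B -> bpath A)
    (beta : bpath C -> bpath B) n l m
    (F : edgeset (bV A n) (bV B l)) (G : edgeset (bV B l) (bV C m)) :
  codes alpha F -> codes beta G -> codes (alpha \o beta) (ecomp F G).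
Proof.
move=> [P [aP PF]] [Q [bQ QG]]; exists (P \o Q); split=> [x|w].
  by rewrite /= aP bQ.
rewrite map_comp QG map_flatten -map_comp.
rewrite word_ecomp map_flatten flatten_flatten.
by rewrite -!map_comp; congr flatten; apply: eq_map => v; rewrite /= PF.
Qed.

Lemma codes_bE (B : obratteli) n : codes id (bE B n).
Proof.
exists (fun p : lpath B n.+1 => (val p).1); split=> // w.
exact: fib_ecomp_fst.
Qed.

Lemma codes_eid (B : obratteli) n : codes (@id (bpath B)) (eid (bV B n)).
Proof.
exists id; split=> // w; rewrite map_id.
have -> : word (eid (bV B n)) w = [:: w].
  by rewrite /word fib_eid.
by rewrite /= cats0.
Qed.

Lemma codes_Elev (B : obratteli) k l (kl : k <= l) :
  codes (@id (bpath B)) (Elev B kl).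
Proof.
rewrite /Elev; move: (l - k) (subnK kl) => d e {kl}.
elim: d l e => [|d IH] l e.
  have kl : k = l := e; case: l / kl in e *.
  have [u [iu _]] := eiso_cast_id B e.
  have [u' [iu' _ _]] := eiso_inv iu.
  by apply: codes_eiso (codes_eid B k); exists u'.
case: l e => [|l] e; first by [].
have e' : d + k = l by apply: succn_inj; rewrite -addSn.
have [t [it _]] := eiso_cast_snoc B e' e.
apply: codes_eiso (codes_comp (IH l e') (codes_bE B l)).
by exists t.
Qed.

(** The segments in the definition of [Vmap_graph] start at the level
    [pm_lev f 0], which is equal but not convertible to 0; hence the level [k]
    here. *)
Lemma lpath_Elev0 (B : obratteli) k l (kl : k <= l) : k = 0 ->
  exists i : lpath B l -> Elev B kl, oiso i /\ forall x, i (pre x l) = seg x kl.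
Proof.
move=> k0; subst k; rewrite /Elev /seg.
move: (l - 0) (subnK kl) => d e {kl}.
suff [i [/eiso_oiso ii iE]] : exists i : lpath B l -> ecast_rng e (epath B 0 d),
    is_eiso i /\ forall x, i (pre x l) = val (segs x 0 d) by exists i.
elim: l d e => [|l IH] d e.
  have [u [iu uE]] := eiso_cast_id B e; have [u' [iu' uu' u'u]] := eiso_inv iu.
  by exists u'; split=> // x; rewrite -[RHS]uu' uE.
case: d e => [|d] e; first by [].
have e' : d + 0 = l by apply: succn_inj; rewrite -addSn.
have [i [ii iE]] := IH _ e'.
have [t [it tE]] := eiso_cast_snoc B e' e.
have [j [ij jE]] := eiso_ecomp ii (eiso_id (bE B l)).
exists (t \o j); split; first exact: eiso_comp.
by move=> x; apply: tE; rewrite jE /= -/(pre x l) iE.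
Qed.

Lemma oiso_comp (S S' S'' T : finType) (F : edgeset S T) (F' : edgeset S' T)
    (F'' : edgeset S'' T) (h : F -> F') (h' : F' -> F'') :
  oiso h -> oiso h' -> oiso (h' \o h).
Proof.
move=> [bh hr hl] [bh' hr' hl']; split; first exact: bij_comp.
- by move=> e; rewrite /= hr' hr.
- by move=> e e'; rewrite /= hl' hl.
Qed.

(** Composing on the left with a single edge from a single vertex. *)
Lemma oiso_ecomp_single (S T U : finType) (F : edgeset S T) (G : edgeset T U) :
  #|F| = 1 -> #|T| = 1 -> oiso (fun p : ecomp F G => (val p).2).
Proof.
move=> F1 T1.
have /card_le1_eqP F1' : #|F| <= 1 by rewrite F1.
have /card_le1_eqP T1' : #|T| <= 1 by rewrite T1.
have [f _] : exists f : F, true.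
  by have /card_gt0P[f _] : 0 < #|F|; [rewrite F1|exists f].
split=> //.
  have fg (g : G) : rng f == src g by apply/eqP/T1'.
  exists (fun g => exist _ (f, g) (fg g) : ecomp F G) => // [[[f' g] f'g]].
  by apply: val_inj; congr (_, _); exact: F1'.
move=> p q; rewrite /= /comp_le /elt.
have [E|//] := eqVneq; last by rewrite orbF.
by rewrite E /= ele_refl (F1' (val p).1 (val q).1) ?ele_refl.
Qed.

(** At level 0 all prefixes are equal, and a single edge codes any map. *)
Lemma codes_level0 (B C : obratteli) (alpha : bpath C -> bpath B) l
    (F : edgeset (bV B 0) (bV C l)) : l = 0 -> #|F| = 1 -> codes alpha F.
Proof.
move=> l0; subst l => F1.
have /card_le1_eqP V1 : #|bV C 0| <= 1 by rewrite bV0.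
have /card_le1_eqP F1' : #|F| <= 1 by rewrite F1.
have [f _] : exists f : F, true.
  by have /card_gt0P[f _] : 0 < #|F|; [rewrite F1|exists f].
exists (fun=> src f : lpath B 0); split=> [x|w]; first exact: lpath0.
have -> : word F w = [:: src f].
  rewrite /word (_ : fib F w = [:: f]) //; apply: fib_charac => // e.
  rewrite (F1' e f) // !inE.
  by transitivity true; [exact/eqP|apply/esym/eqP; exact: V1].
by rewrite /= !fib_eid.
Qed.

(** The definition of [Vmap f x] uses an isomorphism that may depend on [x].
    The map [P] on finite paths induced by it does not, as it is determined by
    its values on the towers. *)
Lemma codes_Vmap (B C : obratteli) (f : premorphism B C) n :
  codes (Vmap f) (pm_edge f n).
Proof.
have T1 : #|bV C (pm_lev f 0)| = 1 by rewrite pm_lev0 bV0.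
have sndO := oiso_ecomp_single (Elev C (pm_lev_mono f n)) (pm_edge0 f) T1.
have [i [oi iE]] := lpath_Elev0 C (pm_lev_mono f n) (pm_lev0 f).
have [j [oj jE]] := lpath_Elev0 B (leq0n n) erefl.
case: (oj) => -[j' jK j'K] _ _.
case: (sndO) => -[k sK kK] _ _.
have ok : oiso k.
  case: sndO => _ sr sl; split; first by exists (fun p => (val p).2).
  - by move=> e; rewrite -sr kK.
  - by move=> e e'; rewrite -sl !kK.
have [n0|n0] := posnP n.
  subst n; apply: codes_level0; [exact: pm_lev0|exact: pm_edge0].
(* [i] and [j] identify finite paths with edges of [Elev], and [k] puts the
   single edge of level 0 in front. *)
have ex x : exists P : lpath C (pm_lev f n) -> lpath B n,
    pre (Vmap f x) n = P (pre x (pm_lev f n)) /\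
    (forall w, map P (fib (lpath C (pm_lev f n)) w) =
               flatten (map (fib (lpath B n)) (word (pm_edge f n) w))).
  have [h [p [ih px hp]]] := VmapP f x n0.
  exists (fun q => j' (val (h (k (i q)))).1); split.
    by rewrite iE -px sK hp -jE jK.
  move=> w.
  transitivity (map j' (map (fun p => (val p).1) (map (h \o (k \o i))
    (fib (lpath C (pm_lev f n)) w)))); first by rewrite -!map_comp.
  rewrite (map_oiso_fib w (oiso_comp (oiso_comp oi ok) (eiso_oiso ih))).
  rewrite fib_ecomp_fst map_flatten -map_comp; congr flatten.
  apply: eq_map => v /=; rewrite -(map_oiso_fib v oj) -map_comp.
  by rewrite (eq_map (g := id)) ?map_id // => q /=; rewrite jK.
have [w0 _] : exists w : bV C (pm_lev f n), true.
  by have /card_gt0P[w _] := bV_neq0 C (pm_lev f n); exists w.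
have [p0 _] := lpath_surj w0; have [x0 _] := ex_bpath p0.
have [P [_ PF]] := ex x0; exists P; split=> // x.
have [Q [-> QF]] := ex x.
have /eq_in_map : map Q (fib (lpath C _) (rng (pre x (pm_lev f n)))) =
    map P (fib (lpath C _) (rng (pre x (pm_lev f n)))) by rewrite PF QF.
by apply; rewrite mem_fib.
Qed.

(** * Coded maps commute with the Vershik maps *)

Section CodeSteps.
Variables (B C : obratteli) (n l : nat) (F : edgeset (bV B n) (bV C l)).
Variable P : lpath C l -> lpath B n.
Hypothesis PF : forall w, map P (fib (lpath C l) w) =
  flatten (map (fib (lpath B n)) (word F w)).

Let flatten_fib_step (ts : seq (bV B n)) (b : lpath B n) : emaximal b ->
  path estep b (flatten (map (fib (lpath B n)) ts)) /\
  emaximal (last b (flatten (map (fib (lpath B n)) ts))).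
Proof. exact: path_flatten_estep (@fib_lpath_neq0 B n). Qed.

Let exmax : exists b : lpath B n, emaximal b.
Proof.
have /card_gt0P[v _] := bV_neq0 B n; case E : (fib (lpath B n) v) => [|e s].
  by have := fib_lpath_neq0 v; rewrite E.
by exists (last e s); exact: fib_last E.
Qed.

Lemma code_emaximal p : emaximal p -> emaximal (P p).
Proof.
move=> pmax; have [s1 [s2 E]] := fib_split p.
move: pmax; rewrite (split_emaximal E) => /nilP s20; subst s2.
have [b bmax] := exmax; have [_] := flatten_fib_step (word F (rng p)) bmax.
by rewrite -PF E map_cat last_cat.
Qed.

Lemma code_eminimal p : eminimal p -> eminimal (P p).
Proof.
move=> pmin; have [s1 [s2 E]] := fib_split p.
move: pmin; rewrite (split_eminimal E) => /nilP s10; subst s1.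
have [b bmax] := exmax; have [+ _] := flatten_fib_step (word F (rng p)) bmax.
by rewrite -PF E /= {1}/estep bmax => /andP[].
Qed.

Lemma code_estep p q : estep p q -> estep (P p) (P q).
Proof.
rewrite {1}/estep; case: ifPn => [pmax qmin|_].
  by rewrite /estep code_emaximal // code_eminimal.
have [s1 [s2 E]] := fib_split p; rewrite (split_esucc E) => /eqP s2q.
have [b bmax] := exmax; have [+ _] := flatten_fib_step (word F (rng p)) bmax.
rewrite -PF E map_cat cat_path /=.
by case: s2 s2q {E} => // q' s [->] /= /and4P[].
Qed.

End CodeSteps.

Lemma codes_equivariant (B C : pobratteli) (alpha : bpath C -> bpath B) :
  (forall n, exists l (F : edgeset (bV B n) (bV C l)), codes alpha F) ->
  alpha (xmax C) = xmax B /\ alpha \o @vershik C =1 @vershik B \o alpha.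
Proof.
move=> code; split=> [|x].
  apply/max_pathE => n; have [l [F [P [aP PF]]]] := code n.+1.
  suff /emaximal_pre : emaximal (pre (alpha (xmax C)) n.+1) by exact.
  rewrite aP; apply: (code_emaximal PF).
  by apply/emaximal_pre => i _; exact: xmaxP.
apply: estep_vershik => n; have [l [F [P [aP PF]]]] := code n.
by rewrite /= !aP; apply: (code_estep PF); exact: vershik_estep.
Qed.

(** * Existence of codes *)

(** The hypotheses on [alpha]: the prefix of length [l] of [x] determines the
    prefix of length [n] of [alpha x], extremal prefixes are sent to extremal
    ones, and [alpha] commutes with the Vershik maps. Along a tower the images
    then move by [estep], so that [estep_path_flatten] applies. *)
Lemma codes_exists (B C : pobratteli) (alpha : bpath C -> bpath B) n l :
  (forall x z, pre x l = pre z l -> pre (alpha x) n = pre (alpha z) n) ->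
  (forall x, emaximal (pre x l) -> emaximal (pre (alpha x) n)) ->
  (forall x, eminimal (pre x l) -> eminimal (pre (alpha x) n)) ->
  alpha \o @vershik C =1 @vershik B \o alpha ->
  exists F : edgeset (bV B n) (bV C l), codes alpha F.
Proof.
move=> aloc amax amin aeq.
pose P p := pre (alpha (sval (cid (@ex_bpath C l p)))) n.
have aP x : pre (alpha x) n = P (pre x l).
  by apply: aloc; rewrite (svalP (cid (ex_bpath (pre x l)))).
have P_succ p q : esucc p q -> estep (P p) (P q).
  have [x <-] := ex_bpath p => pq; have := vershik_estep x l.
  rewrite /estep (negPf (esucc_nmax pq)) => /esucc_inj /(_ pq) <-.
  rewrite -!aP (aeq x : alpha (vershik x) = _); exact: vershik_estep.
have Vw w : exists ts,
    map P (fib (lpath C l) w) = flatten (map (fib (lpath B n)) ts).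
  case E : (fib (lpath C l) w) => [|p s].
    by have := fib_lpath_neq0 w; rewrite E.
  have sP : path estep (P p) (map P s).
    rewrite path_map; apply: sub_path (fib_path E) => q r /=; exact: P_succ.
  have lP : emaximal (last (P p) (map P s)).
    rewrite last_map; have := fib_last E; have [x <-] := ex_bpath (last p s).
    by rewrite -aP; exact: amax.
  have [ts tsE] := estep_path_flatten sP lP.
  have : eminimal (P p).
    have := fib_head E; have [x <-] := ex_bpath p.
    by rewrite -aP; exact: amin.
  have [s1 [s2 E']] := fib_split (P p).
  rewrite (split_eminimal E') => /nilP s10; subst s1.
  exists (rng (P p) :: ts); rewrite /= tsE; congr (_ ++ _).
  by rewrite E' /= eqxx drop0.
have [V VP] := choice Vw.
exists (wedgeset V), P; split=> // w.
by rewrite VP word_wedgeset.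
Qed.

Lemma codes_rng (B C : obratteli) (alpha : bpath C -> bpath B) n l
    (F : edgeset (bV B n) (bV C l)) : codes alpha F ->
  forall w, exists e : F, rng e = w.
Proof.
move=> [P [_ PF]] w; have := PF w; rewrite /word.
case E : (fib F w) => [|e s] /=.
  by case E' : (fib (lpath C l) w) (fib_lpath_neq0 w).
by move=> _; exists e; apply/eqP; rewrite -mem_fib E mem_head.
Qed.

Lemma codes_src (B C : obratteli) (alpha : bpath C -> bpath B) n l
    (F : edgeset (bV B n) (bV C l)) : codes alpha F ->
  (forall y, exists x, alpha x = y) ->
  forall v, exists e : F, src e = v.
Proof.
move=> [P [aP PF]] asurj v; have [q qv] := lpath_surj v.
have [y yq] := ex_bpath q; have [x xy] := asurj y.
have : P (pre x l) \in map P (fib (lpath C l) (rng (pre x l))).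
  by apply: map_f; rewrite mem_fib.
rewrite PF -aP xy yq => /flatten_mapP[v' /mapP[e _ ->{v'}]].
by rewrite mem_fib qv => /eqP ve; exists e.
Qed.

(** The tower of a vertex of level 0 has a single element. *)
Lemma codes_card1 (B C : obratteli) (alpha : bpath C -> bpath B) l
    (F : edgeset (bV B 0) (bV C l)) : l = 0 -> codes alpha F -> #|F| = 1.
Proof.
move=> l0; subst l => -[P [aP PF]].
have /card_le1_eqP V1 : #|bV C 0| <= 1 by rewrite bV0.
have [w _] : exists w : bV C 0, true.
  by have /card_gt0P[w _] := bV_neq0 C 0; exists w.
have <- : size (fib F w) = #|F|.
  rewrite size_sort -cardE; apply: eq_card => e; rewrite !inE.
  by apply/eqP; exact: V1.
have := congr1 size (PF w).
rewrite size_map fib_eid size_flatten /shape -map_comp.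
rewrite (eq_map (g := fun=> 1)); last by move=> v; rewrite /= fib_eid.
by rewrite /word -map_comp sumnE big_map sum1_size => <-.
Qed.

(** * Continuity and compactness *)

Local Open Scope classical_set_scope.

Lemma open_bpathE (B : obratteli) (A : set (bpath B)) : open A = bpath_open A.
Proof. by []. Qed.

Lemma nbhs_bpathP (B : obratteli) (x : bpath B) (A : set (bpath B)) :
  nbhs x A <-> exists n, forall z, pre x n = pre z n -> A z.
Proof.
rewrite nbhsE; split.
  move=> [U [oU Ux] UA]; have [n xU] := oU x Ux; exists n => z xz.
  by apply/UA/xU => i /(proj1 (eq_preP _ _ _) xz) ->.
move=> [n nA]; exists (cylinder x n); last first.
  move=> z xz; apply: nA; apply/eq_preP => i ik; by rewrite xz.
split; last by [].
by rewrite open_bpathE => z xz; exists n => u zu i ik; rewrite zu // xz.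
Qed.

Lemma bpath_continuousP (B C : obratteli) (alpha : bpath C -> bpath B) :
  continuous alpha <-> forall x n, exists l, forall z, pre x l = pre z l ->
    pre (alpha x) n = pre (alpha z) n.
Proof.
split=> [ac x n|ac x A /nbhs_bpathP[n nA]].
  have : nbhs x (alpha @^-1` [set y | pre (alpha x) n = pre y n]).
    by apply: ac; apply/nbhs_bpathP; exists n.
  by move/nbhs_bpathP.
have [l lP] := ac x n; apply/nbhs_bpathP; exists l => z /lP; exact: nA.
Qed.

Section Compactness.
Variables (C : pobratteli).
Hypothesis Ccompact : compact [set: bpath C].

(** If each point has a cylinder on which [Q l] holds for all large [l], then
    [Q l] holds everywhere for all large [l]. *)
Lemma compact_eventually (Q : nat -> bpath C -> Prop) :
  (forall x, exists N, forall l z, N <= l -> pre x N = pre z N -> Q l z) ->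
  exists N, forall l z, N <= l -> Q l z.
Proof.
move=> loc; have /compact_near_coveringP cov := Ccompact.
have [|N _ NQ] := cov nat \oo Q _.
  move=> x _; have [N NQ] := loc x.
  exists ([set z | pre x N = pre z N], [set l | N <= l]) => /=.
    split; first by apply/nbhs_bpathP; exists N.
    by exists N.
  by move=> [z l] /= [xz Nl]; exact: NQ.
by exists N => l z Nl; exact: NQ.
Qed.

Lemma uniform_local (B : obratteli) (alpha : bpath C -> bpath B) n :
  continuous alpha -> exists N, forall l, N <= l -> forall x z,
    pre x l = pre z l -> pre (alpha x) n = pre (alpha z) n.
Proof.
move=> /bpath_continuousP ac.
have [|N NP] := @compact_eventually (fun l x => forall z, pre x l = pre z l ->
    pre (alpha x) n = pre (alpha z) n).
  move=> x; have [N NP] := ac x n; exists N => l z Nl xz u zu.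
  by rewrite -(NP _ xz) -(NP u) // xz; exact: eq_pre_le zu.
by exists N => l Nl x z; exact: NP.
Qed.

(** The maximal path being unique, long maximal prefixes agree with it up to
    level [k]. *)
Lemma uniform_max k : exists N, forall l, N <= l -> forall x,
  emaximal (pre x l) -> pre x k = pre (xmax C) k.
Proof.
have [|N NP] := @compact_eventually (fun l x => emaximal (pre x l) ->
    pre x k = pre (xmax C) k); last by exists N => l Nl x; exact: NP.
move=> x; have [/max_pathE->|nmax] := pselect (max_path x).
  by exists k => l z _ ->.
have [i ni] : exists i, ~~ emaximal (x i).
  apply: contrapT => nk; apply: nmax => n; apply: contrapT => /negP xn.
  by apply: nk; exists n.
exists i.+1 => l z il /eq_preP xz /emaximal_pre zmax.
by rewrite xz // zmax in ni.
Qed.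

Lemma uniform_min k : exists N, forall l, N <= l -> forall x,
  eminimal (pre x l) -> pre x k = pre (xmin C) k.
Proof.
have [|N NP] := @compact_eventually (fun l x => eminimal (pre x l) ->
    pre x k = pre (xmin C) k); last by exists N => l Nl x; exact: NP.
move=> x; have [/min_pathE->|nmin] := pselect (min_path x).
  by exists k => l z _ ->.
have [i ni] : exists i, ~~ eminimal (x i).
  apply: contrapT => nk; apply: nmin => n; apply: contrapT => /negP xn.
  by apply: nk; exists n.
exists i.+1 => l z il /eq_preP xz /eminimal_pre zmin.
by rewrite xz // zmin in ni.
Qed.

(** * The premorphism of a pointed factor map *)

Section Factor.
Variables (B : pobratteli) (alpha : bpath C -> bpath B).
Hypothesis acont : continuous alpha.
Hypothesis aeq : alpha \o @vershik C =1 @vershik B \o alpha.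
Hypothesis amax : alpha (xmax C) = xmax B.

Lemma alpha_xmin : alpha (xmin C) = xmin B.
Proof. by rewrite -!vershik_xmax -amax; exact: aeq. Qed.

(** [k] is a level that determines the prefixes of length [n] of the images;
    from level [N1] (resp. [N2]) on, a maximal (resp. minimal) prefix agrees up
    to [k] with the maximal (resp. minimal) path, whose image is known. *)
Lemma large_codes n : exists N, forall l, N <= l ->
  exists F : edgeset (bV B n) (bV C l), codes alpha F.
Proof.
have [k kP] := uniform_local n acont.
have [N1 N1P] := uniform_max k; have [N2 N2P] := uniform_min k.
exists (maxn k (maxn N1 N2)) => l; rewrite !geq_max => /and3P[kl N1l N2l].
apply: codes_exists aeq.
- exact: kP.
- move=> x /(N1P l N1l) E; rewrite (kP k (leqnn k) _ _ E) amax.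
  by apply/emaximal_pre => i _; exact: xmaxP.
- move=> x /(N2P l N2l) E; rewrite (kP k (leqnn k) _ _ E) alpha_xmin.
  by apply/eminimal_pre => i _; exact: xminP.
Qed.

(** The first edge set of a premorphism has to end at level 0, which
    [large_codes] does not provide. *)
Lemma zero_codes : exists F : edgeset (bV B 0) (bV C 0), codes alpha F.
Proof.
have all0 (D : obratteli) (p q : lpath D 0) : ele p q ==> (q == p).
  by rewrite (lpath0 p q) eqxx implybT.
apply: codes_exists aeq.
- by move=> x z _; exact: lpath0.
- by move=> x _; apply/forallP => p; exact: all0.
- move=> x _; apply/forallP => p; rewrite (lpath0 p (pre (alpha x) 0)).
  exact: all0.
Qed.

Hypothesis asurj : forall y, exists x, alpha x = y.

(** The codes of [alpha] at strictly increasing levels form a premorphism. *)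
Lemma factor_premorphism : exists f : premorphism B C, Vmap f =1 alpha.
Proof.
pose N n := sval (cid (large_codes n)).
have NP n l : N n <= l -> exists F : edgeset (bV B n) (bV C l), codes alpha F.
  exact: svalP (cid (large_codes n)) l.
pose fix lev n := if n is n'.+1 then maxn (lev n').+1 (N n) else 0.
have levS n : lev n < lev n.+1 by rewrite leq_maxl.
have lev_codes n : exists F : edgeset (bV B n) (bV C (lev n)), codes alpha F.
  by case: n => [|n]; [exact: zero_codes|apply: NP; exact: leq_maxr].
pose F n := sval (cid (lev_codes n)).
have FP n : codes alpha (F n) := svalP (cid (lev_codes n)).
have mono n : lev n <= lev n.+1 by exact: ltnW.
have unb m : exists n, m < lev n.
  exists m.+1; elim: m => [|m IH]; [exact: levS|exact: leq_ltn_trans IH _].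
have ne n : 0 < #|F n|.
  have /card_gt0P[w _] := bV_neq0 C (lev n).
  have [e _] := codes_rng (FP n) w; apply/card_gt0P.
  by exists e.
(* Both sides code [alpha] between the same two levels. *)
have comm n : eiso (ecomp (bE B n) (F n.+1)) (ecomp (F n) (Elev C (mono n))).
  apply: word_eiso.
  apply: (codes_word (codes_comp (codes_bE B n) (FP n.+1))
                     (codes_comp (FP n) (codes_Elev C (mono n)))).
  by [].
pose f := (@Premorphism B C lev F erefl mono unb ne
   (fun n => codes_src (FP n) asurj) (fun n => codes_rng (FP n))
   (codes_card1 erefl (FP 0)) comm).
exists f => x; apply: pre_inj => n; exists n => //.
exact: (codes_eq_pre (codes_Vmap f n) (FP n)).
Qed.

End Factor.
End Compactness.

(** * The map of a premorphism determines its class *)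

Lemma Vmap_codes_ex (B C : obratteli) (f : premorphism B C) n :
  exists l (F : edgeset (bV B n) (bV C l)), codes (Vmap f) F.
Proof. by exists (pm_lev f n), (pm_edge f n); exact: codes_Vmap. Qed.

Lemma Vmap_continuous (B C : obratteli) (f : premorphism B C) :
  continuous (Vmap f).
Proof.
apply/bpath_continuousP => x n; have [P [aP _]] := codes_Vmap f n.
by exists (pm_lev f n) => z xz; rewrite !aP xz.
Qed.

Lemma pm_lev_homo (B C : obratteli) (f : premorphism B C) n m :
  n <= m -> pm_lev f n <= pm_lev f m.
Proof. exact: (homo_leq leqnn leq_trans (pm_mono f)). Qed.

Lemma pm_lev_large (B C : obratteli) (f : premorphism B C) N M :
  exists n, (N < n) && (M < pm_lev f n).
Proof.
have [n Mn] := pm_unbounded f M; exists (maxn n N.+1).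
rewrite leq_maxr /=; apply: leq_trans Mn _.
by apply: pm_lev_homo; exact: leq_maxl.
Qed.

Lemma Vmap_eiso (B C : obratteli) (f g : premorphism B C) n m
    (nm : n <= m) (fg : pm_lev f n <= pm_lev g m) : Vmap f =1 Vmap g ->
  eiso (ecomp (Elev B nm) (pm_edge g m)) (ecomp (pm_edge f n) (Elev C fg)).
Proof.
move=> E; apply: word_eiso.
apply: (codes_word (codes_comp (codes_Elev B nm) (codes_Vmap g m))
                   (codes_comp (codes_Vmap f n) (codes_Elev C fg))) => x.
by rewrite /= E.
Qed.

Lemma pm_equivP (B C : obratteli) (f g : premorphism B C) :
  pm_equiv f g <-> Vmap f =1 Vmap g.
Proof.
split.
  move=> [n [m [nm [mn [fg [gf [n0 E _]]]]]]] x.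
  have nk k : k <= n k.
    by elim: k => // k IH; apply: leq_ltn_trans IH (ltn_trans (nm k) (mn k)).
  apply: pre_inj => N; exists (n N) => //.
  exact: (codes_eq_pre (codes_comp (codes_Vmap f (n N)) (codes_Elev C _))
                       (codes_comp (codes_Elev B _) (codes_Vmap g (m N)))
                       (fsym (eiso_word (E N)))).
move=> E.
pose nextf N M := ex_minn (pm_lev_large f N M).
pose nextg N M := ex_minn (pm_lev_large g N M).
have nextfP N M : N < nextf N M /\ M < pm_lev f (nextf N M).
  by rewrite /nextf; case: ex_minnP => k /andP[].
have nextgP N M : N < nextg N M /\ M < pm_lev g (nextg N M).
  by rewrite /nextg; case: ex_minnP => k /andP[].
pose m_of n := nextg n (pm_lev f n).
pose n_of m := nextf m (pm_lev g m).
pose n k := iter k (n_of \o m_of) 1; pose m k := m_of (n k).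
have nm k : n k < m k := proj1 (nextgP _ _).
have mn k : m k < n k.+1 := proj1 (nextfP _ _).
have fg k : pm_lev f (n k) < pm_lev g (m k) := proj2 (nextgP _ _).
have gf k : pm_lev g (m k) < pm_lev f (n k.+1) := proj2 (nextfP _ _).
(* The levels were chosen alternately, each one large enough with respect to
   the previous one; [Vmap_eiso] has no further condition on the levels. *)
exists n, m, nm, mn, fg, gf; split=> // k; first exact: Vmap_eiso.
by apply: Vmap_eiso => x; rewrite E.
Qed.

(** * The correspondence *)

(** Each vertex of level [n] is the source of an edge of [pm_edge f n], so that
    each finite path is the prefix of some [Vmap f x]: the image is dense, and
    it is closed by compactness. *)
Lemma Vmap_surj (B C : pobratteli) (f : premorphism B C) :
  compact [set: bpath C] -> forall y, exists x, Vmap f x = y.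
Proof.
move=> cC y; apply: contrapT => /forallNP ny.
have [|N NP] := @compact_eventually C cC
    (fun l z => pre (Vmap f z) l <> pre y l).
  move=> x; have [n nxy] : exists n, pre (Vmap f x) n <> pre y n.
    apply: contrapT => /forallNP E; apply: (ny x); apply: pre_inj => n.
    by exists n => //; apply: contrapT; exact: E.
  have /bpath_continuousP/(_ x n)[k kP] := @Vmap_continuous B C f.
  exists (maxn k n) => l z; rewrite geq_max => /andP[_ nl] xz zy.
  apply: nxy; rewrite (kP z); first exact: eq_pre_le zy.
  by apply: eq_pre_le xz; exact: leq_maxl.
have [P [aP PF]] := codes_Vmap f N.
have [e ev] := @pm_src B C f N (rng (pre y N)).
have : pre y N \in flatten (map (fib (lpath B N)) (word (pm_edge f N) (rng e))).
  apply/flatten_mapP; exists (rng (pre y N)); last by rewrite mem_fib.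
  by rewrite -ev; apply: map_f; rewrite mem_fib.
rewrite -PF => /mapP[p _ yp]; have [x xp] := ex_bpath p.
by apply: (NP N x (leqnn N)); rewrite aP xp.
Qed.

Lemma homeomorphism_compact (X Y : topologicalType) (h : X -> Y) :
  homeomorphism h -> compact [set: X] -> compact [set: Y].
Proof.
move=> [hc [g [_ hK gK]]] cX.
have -> : [set: Y] = h @` [set: X].
  by apply/seteqP; split=> // y _; exists (g y).
by apply: continuous_compact cX; apply: continuous_subspaceT.
Qed.

Lemma homeomorphism_inv (X Y : topologicalType) (h : X -> Y) :
  homeomorphism h -> exists g : Y -> X, homeomorphism g.
Proof. by move=> [hc [g [gc hK gK]]]; exists g; split=> //; exists h. Qed.

Section Correspondence.
Variables (X Y : topologicalType) (phi : X -> X) (psi : Y -> Y).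
Variables (x : X) (y : Y) (C B : pobratteli).
Variables (thX : X -> bpath C) (thY : Y -> bpath B).
Hypothesis phi_min : cantor_minimal phi.
Hypothesis cX : pointed_conjugacy phi x thX.
Hypothesis cY : pointed_conjugacy psi y thY.

Let compactC : compact [set: bpath C].
Proof.
have [hX _ _] := cX; apply: homeomorphism_compact hX _.
have [[h hh] _ _] := phi_min; have [g gh] := homeomorphism_inv hh.
exact: homeomorphism_compact gh cantor_space_compact.
Qed.

Lemma Vmap_factor (f : premorphism B C) : exists a : pointed_factor phi psi x y,
  thY \o a =1 Vmap f \o thX.
Proof.
have [[tXc [gX [gXc tXK gXK]]] tXe tXx] := cX.
have [[tYc [gY [gYc tYK gYK]]] tYe tYy] := cY.
have [fmax feq] := codes_equivariant (Vmap_codes_ex f).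
have fa : factor_map phi psi (gY \o (Vmap f \o thX)).
  split.
  - move=> z; apply: continuous_comp; last exact: gYc.
    by apply: continuous_comp; [exact: tXc|exact: Vmap_continuous].
  - move=> y'; have [z zy] := Vmap_surj f compactC (thY y').
    by exists (gX z); rewrite /= gXK zy tYK.
  - move=> x'; apply: (can_inj tYK); rewrite /= gYK.
    have := tYe (gY (Vmap f (thX x'))); rewrite /= => ->.
    have := tXe x'; rewrite /= => ->.
    by rewrite gYK; exact: feq.
have pa : (gY \o (Vmap f \o thX)) x = y.
  by apply: (can_inj tYK); rewrite /= gYK tXx fmax tYy.
by exists (PointedFactor fa pa) => x' /=; rewrite gYK.
Qed.

Lemma factor_Vmap (a : X -> Y) : factor_map phi psi a -> a x = y ->
  exists f : premorphism B C, thY \o a =1 Vmap f \o thX.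
Proof.
have [[tXc [gX [gXc tXK gXK]]] tXe tXx] := cX.
have [[tYc [gY [gYc tYK gYK]]] tYe tYy] := cY.
move=> [ac asurj ae] ax; pose alpha := thY \o (a \o gX).
have [||||f fE] := @factor_premorphism C compactC B alpha.
- move=> z; apply: continuous_comp; last exact: tYc.
  by apply: continuous_comp; [exact: gXc|exact: ac].
- move=> z; apply: esym; have := tYe (a (gX z)); rewrite /= => <-.
  have := ae (gX z); rewrite /= => <-; rewrite /alpha /=.
  congr (thY (a _)); apply: (can_inj tXK); rewrite gXK.
  by rewrite [LHS](tXe (gX z)) /= gXK.
- by rewrite /alpha /= -tXx tXK ax tYy.
- move=> y'; have [x' xy'] := asurj (gY y').
  by exists (thX x'); rewrite /alpha /= tXK xy' gYK.
exists f => x'; by rewrite /= fE /alpha /= tXK.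
Qed.

Lemma pm_quot_eq (q q' : pm_quot B C) : pm_mem q = pm_mem q' -> q = q'.
Proof.
case: q q' => [m mP] [m' mP'] /= E; subst m'.
by rewrite (Prop_irrelevance mP mP').
Qed.

Lemma pm_classP (f g : premorphism B C) :
  pm_class f = pm_class g <-> Vmap f =1 Vmap g.
Proof.
split=> [E|E].
  have fg : pm_equiv f = pm_equiv g := congr1 (@pm_mem B C) E.
  apply/pm_equivP; rewrite fg.
  exact/pm_equivP.
apply: pm_quot_eq; apply: functional_extensionality_dep => h /=.
by apply/propext; split=> /pm_equivP E'; apply/pm_equivP => z; rewrite -E' E.
Qed.

Lemma pm_quot_class (q : pm_quot B C) : exists f, q = pm_class f.
Proof. by have [f fE] := pm_memP q; exists f; exact: pm_quot_eq. Qed.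

Lemma pointed_factor_eq (a b : pointed_factor phi psi x y) :
  thY \o a =1 thY \o b -> a = b.
Proof.
have [[tYc [gY [gYc tYK gYK]]] tYe tYy] := cY.
case: a b => [a af ax] [b bf bx] /= E.
have ab : a = b.
  by apply: functional_extensionality_dep => z; apply: (can_inj tYK); exact: E.
by subst b; rewrite (Prop_irrelevance af bf) (Prop_irrelevance ax bx).
Qed.

Lemma premorphism_factor_bijection :
  exists Phi : pm_quot B C -> pointed_factor phi psi x y,
    bijective Phi /\
    forall f : premorphism B C, thY \o Phi (pm_class f) =1 Vmap f \o thX.
Proof.
have ex_Phi q : exists a : pointed_factor phi psi x y,
    forall f, q = pm_class f -> thY \o a =1 Vmap f \o thX.
  have [f ->] := pm_quot_class q; have [a aE] := Vmap_factor f.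
  by exists a => g /pm_classP E z; rewrite aE /= E.
have ex_Psi (a : pointed_factor phi psi x y) :
    exists f : premorphism B C, thY \o a =1 Vmap f \o thX.
  exact: factor_Vmap (pf_factor a) (pf_point a).
have [Phi PhiE] := choice ex_Phi.
have [Psi PsiE] := choice ex_Psi.
exists Phi; split; last by move=> f; exact: PhiE.
have [[tXc [gX [gXc tXK gXK]]] tXe tXx] := cX.
exists (fun a => pm_class (Psi a)) => [q|a].
  have [f qf] := pm_quot_class q; rewrite [RHS]qf; apply/pm_classP => z.
  have := PsiE (Phi q) (gX z); rewrite (PhiE q f qf) /= gXK.
  by move=> ->.
by apply: pointed_factor_eq => z; rewrite (PhiE _ (Psi a)) // PsiE.
Qed.

End Correspondence.

Theorem proposition4p6 (X Y : topologicalType) (phi : X -> X) (psi : Y -> Y)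
    (x : X) (y : Y) (C B : pobratteli) :
  cantor_minimal phi -> cantor_minimal psi ->
  bv_model phi x C -> bv_model psi y B ->
  ((exists alpha : X -> Y, factor_map phi psi alpha /\ alpha x = y) <->
   (exists f : premorphism B C, True)) /\
  (forall (thX : X -> bpath C) (thY : Y -> bpath B),
    pointed_conjugacy phi x thX -> pointed_conjugacy psi y thY ->
    exists Phi : pm_quot B C -> pointed_factor phi psi x y,
      bijective Phi /\
      forall f : premorphism B C,
        thY \o Phi (pm_class f) =1 Vmap f \o thX).
Proof.
move=> phi_min _ [thX cX] [thY cY]; split; last first.
  by move=> tX tY; exact: premorphism_factor_bijection.
split=> [[a [af ax]]|[f _]].
  by have [f _] := factor_Vmap phi_min cX cY af ax; exists f.
have [a _] := Vmap_factor phi_min cX cY f.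
by exists a; split; [exact: pf_factor|exact: pf_point].
Qed.
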